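(* Let $k$ be a field with at least $8$ elements, and let $\mathfrak{g}$ be a finite-dimensional Lie algebra over $k$. Then $\mathfrak{g}=\mathrm{Lie}(G)$ for some algebraic group $G$ over $k$ if and only if $\mathfrak{g}=\mathrm{Der}(A)$ for some finite-dimensional algebra $A$ over $k$.
   Context: An algebraic group over $k$ is an affine group scheme of finite type over $k$ (not necessarily smooth). An algebra $A$ over $k$ is a $k$-vector space $V$ equipped with a $k$-linear map $V\otimes_k V\to V$, with no further conditions (not necessarily associative, commutative or unital). $\mathrm{Der}(A)$ is the Lie algebra of $k$-linear derivations of $A$. Equalities of Lie algebras are to be read as isomorphisms. *)

(* Defs.v *)
From HB Require Import structures.
From mathcomp Require Import all_boot all_order all_algebra.
From mathcomp Require Import sesquilinear ring.
From mathcomp Require Import boolp functions.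

Set Implicit Arguments.
Unset Strict Implicit.
Unset Printing Implicit Defensive.

Import GRing.Theory.
Local Open Scope ring_scope.

HB.mixin Record Lmodule_isLieAlgebra (k : fieldType) V of GRing.Lmodule k V := {
  lie_bracket : V -> V -> V;
  lie_linear_r : forall x, linear (lie_bracket x);
  lie_linear_l : forall y, linear (lie_bracket^~ y);
  lie_alternating : forall x, lie_bracket x x = 0;
  lie_jacobi : forall x y z,
    lie_bracket x (lie_bracket y z) + lie_bracket y (lie_bracket z x)
      + lie_bracket z (lie_bracket x y) = 0 }.

#[short(type="lieAlgType")]
HB.structure Definition LieAlgebra (k : fieldType) :=
  {V of GRing.Lmodule k V & Lmodule_isLieAlgebra k V}.

#[short(type="vectLieAlgType")]
HB.structure Definition VectLieAlgebra (k : fieldType) :=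
  {V of Vector k V & LieAlgebra k V}.

Definition lie_isomorphic (k : fieldType) (g h : lieAlgType k) : Prop :=
  exists2 f : {linear g -> h}, bijective f &
    forall x y, f (lie_bracket x y) = lie_bracket (f x) (f y).

Definition commutator (V : zmodType) (D E : V -> V) : V -> V :=
  fun x => D (E x) - E (D x).

(* Lie subalgebras of gl(V), with V of any dimension: this covers both Der(A)
   and the left invariant derivations of a coordinate ring. *)
Record lieSubalgebra (k : fieldType) (V : lmodType k) := LieSubalgebra {
  lsub_mem : (V -> V) -> Prop;
  lsub_linear : forall D, lsub_mem D -> linear D;
  lsub0 : lsub_mem (fun=> 0);
  lsubP : forall (a : k) D E,
    lsub_mem D -> lsub_mem E -> lsub_mem (fun x => a *: D x + E x);
  lsub_commutator : forall D E,
    lsub_mem D -> lsub_mem E -> lsub_mem (commutator D E) }.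

Definition lsub_pred (k : fieldType) (V : lmodType k) (S : lieSubalgebra V) :
  {pred (V -> V)} := fun D => `[< lsub_mem S D >].

Lemma lsub_submod_closed (k : fieldType) (V : lmodType k)
  (S : lieSubalgebra V) : submod_closed (lsub_pred S).
Proof.
split; first by apply/asboolP; exact: lsub0.
move=> a D E /asboolP SD /asboolP SE; apply/asboolP.
exact: (lsubP a SD SE).
Qed.

HB.instance Definition _ (k : fieldType) (V : lmodType k)
  (S : lieSubalgebra V) :=
  GRing.isSubmodClosed.Build k (V -> V) (lsub_pred S) (lsub_submod_closed S).

Record lie_of (k : fieldType) (V : lmodType k) (S : lieSubalgebra V) :=
  LieOf { endo_of :> V -> V; endo_ofP : endo_of \in lsub_pred S }.

HB.instance Definition _ (k : fieldType) (V : lmodType k)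
  (S : lieSubalgebra V) := [isSub for @endo_of k V S].
HB.instance Definition _ (k : fieldType) (V : lmodType k)
  (S : lieSubalgebra V) := [Choice of lie_of S by <:].
HB.instance Definition _ (k : fieldType) (V : lmodType k)
  (S : lieSubalgebra V) := [SubChoice_isSubLmodule of lie_of S by <:].

Lemma lie_of_commutatorP (k : fieldType) (V : lmodType k)
  (S : lieSubalgebra V) (D E : lie_of S) : commutator D E \in lsub_pred S.
Proof.
apply/asboolP.
by apply: lsub_commutator; apply/asboolP; exact: endo_ofP.
Qed.

Definition lie_of_bracket (k : fieldType) (V : lmodType k)
  (S : lieSubalgebra V) (D E : lie_of S) : lie_of S :=
  LieOf (lie_of_commutatorP D E).

Section LieOf.
Context (k : fieldType) (V : lmodType k) (S : lieSubalgebra V).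
Implicit Types D E F : lie_of S.

Lemma lie_of_ext D E : (forall x, D x = E x) -> D = E.
Proof. by move=> DE; apply/val_inj/funext. Qed.

Lemma endo_ofZD (a : k) D E x : (a *: D + E : lie_of S) x = a *: D x + E x.
Proof. by []. Qed.

Lemma endo_ofD D E x : (D + E : lie_of S) x = D x + E x.
Proof. by []. Qed.

Lemma endo_of0 x : (0 : lie_of S) x = 0.
Proof. by []. Qed.

Lemma endo_linear D : linear D.
Proof. by apply: (@lsub_linear _ _ S); apply/asboolP; exact: endo_ofP. Qed.

Lemma endoB D x y : D (x - y) = D x - D y.
Proof.
by rewrite -[x - y]addrC -scaleN1r endo_linear scaleN1r addrC.
Qed.

Lemma lie_of_bracketE D E x :
  lie_of_bracket D E x = D (E x) - E (D x).
Proof. by []. Qed.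

Lemma lie_of_linear_r D : linear (lie_of_bracket D).
Proof.
move=> a E F; apply: lie_of_ext => x.
rewrite endo_ofZD !lie_of_bracketE !endo_ofZD endo_linear scalerBr.
by rewrite opprD addrACA.
Qed.

Lemma lie_of_linear_l E : linear ((@lie_of_bracket k V S)^~ E).
Proof.
move=> a D F; apply: lie_of_ext => x.
rewrite endo_ofZD !lie_of_bracketE !endo_ofZD endo_linear scalerBr.
by rewrite opprD addrACA.
Qed.

Lemma lie_of_alternating D : lie_of_bracket D D = 0.
Proof. by apply: lie_of_ext => x; rewrite /= /commutator subrr. Qed.

Lemma lie_of_jacobi D E F :
  lie_of_bracket D (lie_of_bracket E F) + lie_of_bracket E (lie_of_bracket F D)
    + lie_of_bracket F (lie_of_bracket D E) = 0.
Proof.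
apply: lie_of_ext => x; rewrite !endo_ofD endo_of0.
rewrite !lie_of_bracketE !endoB.
have tele (u v w z s t : V) : u - v - (w - z) + (w - s - (t - v))
    + (t - z - (u - s)) = 0.
  have AB (a b c d : V) : a - b - (c - d) = (a + d) - (c + b).
    by rewrite opprB addrACA -opprD [b + c]addrC.
  by rewrite !AB [X in X + _]addrA subrK addrA subrK subrr.
exact: tele.
Qed.
End LieOf.

HB.instance Definition _ (k : fieldType) (V : lmodType k)
  (S : lieSubalgebra V) :=
  Lmodule_isLieAlgebra.Build k (lie_of S) (@lie_of_linear_r k V S)
    (@lie_of_linear_l k V S) (@lie_of_alternating k V S) (@lie_of_jacobi k V S).

Definition derivation (k : fieldType) (V : lmodType k) (mu : V -> V -> V)
  (D : V -> V) : Prop :=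
  linear D /\ forall x y, D (mu x y) = mu (D x) y + mu x (D y).

Section DerClosed.
Context (k : fieldType) (V : lmodType k) (mu : {bilinear V -> V -> V}).

Lemma derivation0 : derivation mu (fun=> 0).
Proof.
split=> [a x y|x y]; first by rewrite scaler0 addr0.
by rewrite linear0l linear0r addr0.
Qed.

Lemma derivationP (a : k) D E : derivation mu D -> derivation mu E ->
  derivation mu (fun x => a *: D x + E x).
Proof.
move=> [lD dD] [lE dE]; split=> [b x y|x y].
  rewrite lD lE !scalerDr !scalerA [a * b]mulrC -!addrA; congr (_ + _).
  by rewrite addrCA.
by rewrite dD dE linearPl linearPr scalerDr addrACA.
Qed.

Lemma linear_commutator (D E : V -> V) :
  linear D -> linear E -> linear (commutator D E).
Proof.
move=> lD lE a x y.
by rewrite /commutator lE lD lD lE scalerBr opprD addrACA.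
Qed.

Lemma derivation_commutator D E : derivation mu D -> derivation mu E ->
  derivation mu (commutator D E).
Proof.
move=> [lD dD] [lE dE]; split; first exact: linear_commutator.
have addD u v : D (u + v) = D u + D v.
  by rewrite -[u]scale1r lD !scale1r.
have addE u v : E (u + v) = E u + E v.
  by rewrite -[u]scale1r lE !scale1r.
move=> x y; rewrite /commutator dE dD addD addE !dD !dE.
rewrite linearBl linearBr.
have rearr (a b c d e f : V) :
    a + b + (c + d) - (e + c + (b + f)) = a - e + (d - f).
  rewrite [c + d]addrC [b + f]addrC [a + b + _]addrACA [e + c + _]addrACA.
  by rewrite [c + b]addrC [e + f + _]addrC addrKA opprD addrACA.
exact: rearr.
Qed.
End DerClosed.

Definition Der (k : fieldType) (A : lmodType k) (mu : {bilinear A -> A -> A}) :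
  lieAlgType k :=
  lie_of (LieSubalgebra (fun D (dD : derivation mu D) => dD.1)
    (derivation0 mu) (@derivationP k A mu) (@derivation_commutator k A mu)).

(* R[eps]/(eps^2); the pair (a, b) stands for a + eps b. *)
Definition dual (k : fieldType) (R : comAlgType k) : Type := (R * R)%type.

HB.instance Definition _ (k : fieldType) (R : comAlgType k) :=
  GRing.Lmodule.copy (dual R) (R * R)%type.

Definition dual_one (k : fieldType) (R : comAlgType k) : dual R := (1, 0).
Definition dual_mul (k : fieldType) (R : comAlgType k) (x y : dual R) : dual R :=
  (x.1 * y.1, x.1 * y.2 + x.2 * y.1).

Section DualRing.
Context (k : fieldType) (R : comAlgType k).
Implicit Types x y z : dual R.

Lemma dual_mulA : associative (@dual_mul k R).
Proof.
move=> [a a'] [b b'] [c c']; congr (_, _); rewrite /= ?mulrA //.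
by rewrite mulrDr mulrDl !mulrA addrA.
Qed.
Lemma dual_mulC : commutative (@dual_mul k R).
Proof.
move=> [a a'] [b b']; congr (_, _) => /=; first exact: mulrC.
by rewrite addrC mulrC [a * _]mulrC.
Qed.
Lemma dual_mul1 : left_id (dual_one R) (@dual_mul k R).
Proof. by move=> [a a']; congr (_, _); rewrite /= !mul1r // mul0r addr0. Qed.
Lemma dual_mulDl : left_distributive (@dual_mul k R) +%R.
Proof.
move=> [a a'] [b b'] [c c']; congr (_, _); rewrite /= !mulrDl //.
by rewrite addrACA.
Qed.
Lemma dual_one_neq0 : dual_one R != 0.
Proof. by apply/eqP => -[] /eqP; rewrite oner_eq0. Qed.
End DualRing.

HB.instance Definition _ (k : fieldType) (R : comAlgType k) :=
  GRing.Zmodule_isComNzRing.Build (dual R) (@dual_mulA k R) (@dual_mulC k R)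
    (@dual_mul1 k R) (@dual_mulDl k R) (@dual_one_neq0 k R).

Lemma dual_scaleAl (k : fieldType) (R : comAlgType k) (a : k) (x y : dual R) :
  a *: (x * y) = (a *: x : dual R) * y.
Proof.
change ((a *: (x.1 * y.1), a *: (x.1 * y.2 + x.2 * y.1)) =
  ((a *: x.1) * y.1, (a *: x.1) * y.2 + (a *: x.2) * y.1)).
by rewrite scalerDr !scalerAl.
Qed.

HB.instance Definition _ (k : fieldType) (R : comAlgType k) :=
  GRing.Lmodule_isLalgebra.Build k (dual R) (@dual_scaleAl k R).
HB.instance Definition _ (k : fieldType) (R : comAlgType k) :=
  GRing.Lalgebra_isComAlgebra.Build k (dual R).


Definition dual_in (k : fieldType) (R : comAlgType k) (r : R) : dual R := (r, 0).

Lemma dual_in_linear (k : fieldType) (R : comAlgType k) : linear (@dual_in k R).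
Proof.
move=> a x y.
change ((a *: x + y, 0) = (a *: x + y, a *: 0 + 0) :> R * R).
by rewrite scaler0 addr0.
Qed.
Lemma dual_in_monoid (k : fieldType) (R : comAlgType k) :
  monoid_morphism (@dual_in k R).
Proof.
split=> // x y.
change ((x * y, 0) = (x * y, x * 0 + 0 * y) :> R * R).
by rewrite mulr0 mul0r addr0.
Qed.
HB.instance Definition _ (k : fieldType) (R : comAlgType k) :=
  GRing.isLinear.Build k R (dual R) *:%R (@dual_in k R) (@dual_in_linear k R).
HB.instance Definition _ (k : fieldType) (R : comAlgType k) :=
  GRing.isMonoidMorphism.Build R (dual R) (@dual_in k R) (@dual_in_monoid k R).


Definition fin_generated (k : fieldType) (A : comAlgType k) : Prop :=
  exists s : seq A, forall S : {pred A},
    GRing.subalg_closed S -> {subset s <= S} -> forall a, a \in S.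

Definition alg_hom (k : fieldType) (A R : comAlgType k) : Type :=
  {lrmorphism A -> R}.

Definition alg_comp (k : fieldType) (A R S : comAlgType k)
  (f : alg_hom R S) (x : alg_hom A R) : alg_hom A S :=
  f \o x.

(* An affine group scheme of finite type over k: the scheme is Spec of the
   finitely generated k-algebra coord, its R-points are the k-algebra maps
   coord -> R, and the group structure is given on points, functorially in R.
   A comAlgType is a nonzero ring; the zero ring imposes no condition, since
   every scheme has exactly one point with values in it. *)
Record algGroup (k : fieldType) := AlgGroup {
  coord : comAlgType k;
  coord_fin_generated : fin_generated coord;
  gmul : forall R : comAlgType k,
    alg_hom coord R -> alg_hom coord R -> alg_hom coord R;
  gone : forall R : comAlgType k, alg_hom coord R;
  ginv : forall R : comAlgType k, alg_hom coord R -> alg_hom coord R;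
  gmulA : forall R, associative (@gmul R);
  gmul1 : forall R, left_id (gone R) (@gmul R);
  gmulV : forall R, left_inverse (gone R) (@ginv R) (@gmul R);
  gmul_natural : forall (R S : comAlgType k) (f : alg_hom R S)
      (x y : alg_hom coord R),
    alg_comp f (gmul x y) = gmul (alg_comp f x) (alg_comp f y) }.

(* A derivation D is the vector field that carries x in G(R) to the point
   x' = x o (1 + eps D) in G(R[eps]); D is left invariant when left translation
   by every g in G(R) preserves it, i.e. when (id (x) D) o Delta = Delta o D. *)
Definition left_invariant (k : fieldType) (G : algGroup k)
  (D : coord G -> coord G) : Prop :=
  forall (R : comAlgType k) (g x : alg_hom (coord G) R)
    (x' : alg_hom (coord G) (dual R)),
    (forall a, x' a = (x a, x (D a))) ->
    forall a, gmul (alg_comp (@dual_in k R) g) x' a = (gmul g x a, gmul g x (D a)).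

Lemma alg_hom_ext (k : fieldType) (A R : comAlgType k) (x y : alg_hom A R) :
  (forall a, x a = y a) -> x = y.
Proof.
move=> /funext; case: x y => [f [[f1] [f2] [f3]]] [g [[g1] [g2] [g3]]] /= fg.
move: f1 f2 f3; rewrite fg => f1 f2 f3.
by rewrite (Prop_irrelevance f1 g1) (Prop_irrelevance f2 g2)
  (Prop_irrelevance f3 g3).
Qed.

Lemma alg_hom_build (k : fieldType) (A R : comAlgType k) (f : A -> R) :
  linear f -> monoid_morphism f -> exists x : alg_hom A R, forall a, x a = f a.
Proof.
move=> lf mf.
pose L := GRing.isLinear.Build k A R *:%R f lf.
pose M := GRing.isMonoidMorphism.Build A R f mf.
pose x : {lrmorphism A -> R} := HB.pack f L M.
by exists x.
Qed.


Definition alg_mul (k : fieldType) (A : comAlgType k) : A -> A -> A := *%R.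

Lemma alg_mul_bilinear (k : fieldType) (A : comAlgType k) :
  bilinear_for *:%R *:%R (@alg_mul k A).
Proof.
by split=> u a x y; rewrite /alg_mul ?mulrDl ?mulrDr -?scalerAl -?scalerAr.
Qed.

HB.instance Definition _ (k : fieldType) (A : comAlgType k) :=
  bilinear_isBilinear.Build k A A A *:%R *:%R (@alg_mul k A)
    (@alg_mul_bilinear k A).

Lemma derivation1 (k : fieldType) (A : comAlgType k) (D : A -> A) :
  derivation *%R D -> D 1 = 0.
Proof.
move=> [_ /(_ 1 1)]; rewrite !mulr1 mul1r => D1.
by apply: (addrI (D 1)); rewrite addr0 -D1.
Qed.

Lemma commutator_expansion (R : comNzRingType) (e1 e2 z d e de ed dd ded ee dee
    dde ede dede : R) : e1 * e1 = 0 -> e2 * e2 = 0 ->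
  z + e1 * d + e2 * (e + e1 * de)
    + (- e1) * (d + e1 * dd + e2 * (ed + e1 * ded))
    + (- e2) * (e + e1 * de + e2 * (ee + e1 * dee)
        + (- e1) * (de + e1 * dde + e2 * (ede + e1 * dede)))
  = z + e1 * e2 * (de - ed).
Proof.
move=> e10 e20.
transitivity (z + e1 * e2 * (de - ed)
  + e1 * e1 * (- dd - e2 * ded + e2 * dde + e2 * e2 * dede)
  + e2 * e2 * (- ee - e1 * dee + e1 * ede)); first by ring.
by rewrite e10 e20 !mul0r !addr0.
Qed.

Section Evolve.
Context (k : fieldType).

(* The ring map x o (1 + s D), for s^2 = 0. *)
Lemma evolve_hom (A S : comAlgType k) (x : alg_hom A S) (s : S) D :
  derivation *%R D -> s * s = 0 ->
  exists y : alg_hom A S, forall a, y a = x a + s * x (D a).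
Proof.
move=> dD s0; have D1 := derivation1 dD; case: dD => lD dD.
apply: alg_hom_build => [a u v|].
  rewrite lD !linearP mulrDr scalerDr -scalerAr -!addrA; congr (_ + _).
  by rewrite addrCA.
split=> [|u v]; first by rewrite D1 rmorph0 mulr0 addr0 rmorph1.
rewrite dD rmorphD !rmorphM mulrDl !mulrDr -!addrA; congr (_ + _).
rewrite [s * x (D u) * (s * _)]mulrACA s0 mul0r addr0 addrC.
by rewrite !mulrA [x u * s]mulrC.
Qed.

Lemma left_invariant_evolve (G : algGroup k) (D : coord G -> coord G)
    (S : comAlgType k) (s : S) (g x y : alg_hom (coord G) S) :
  derivation *%R D -> left_invariant D -> s * s = 0 ->
  (forall a, y a = x a + s * x (D a)) ->
  forall a, gmul g y a = gmul g x a + s * gmul g x (D a).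
Proof.
move=> dD iD s0 yE.
have [x' x'E] : exists x' : alg_hom (coord G) (dual S),
    forall a, x' a = (x a, x (D a)).
  have e0 : ((0, 1) : dual S) * (0, 1) = 0.
    change ((0 * 0, 0 * 1 + 1 * 0) = (0, 0) :> S * S).
    by rewrite !mul0r mulr0 addr0.
  have [x' x'E] := evolve_hom (alg_comp (@dual_in k S) x) dD e0.
  exists x' => a; rewrite x'E.
  change ((x a + 0 * x (D a), 0 + (0 * 0 + 1 * x (D a))) = (x a, x (D a))).
  by rewrite !mul0r mul1r !add0r addr0.
have [f fE] : exists f : alg_hom (dual S) S, forall r, f r = r.1 + s * r.2.
  apply: alg_hom_build => [a u v|].
    change (a *: u.1 + v.1 + s * (a *: u.2 + v.2) =
      a *: (u.1 + s * u.2) + (v.1 + s * v.2)).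
    by rewrite mulrDr scalerDr -scalerAr addrACA.
  split=> [|u v]; first by rewrite /= mulr0 addr0.
  change (u.1 * v.1 + s * (u.1 * v.2 + u.2 * v.1) =
    (u.1 + s * u.2) * (v.1 + s * v.2)).
  rewrite mulrDl !mulrDr -!addrA; congr (_ + _).
  rewrite [s * u.2 * (s * _)]mulrACA s0 mul0r addr0.
  by rewrite !mulrA [u.1 * s]mulrC.
have -> : y = alg_comp f x' by apply: alg_hom_ext => a /=; rewrite fE x'E yE.
have {1}-> : g = alg_comp f (alg_comp (@dual_in k S) g).
  by apply: alg_hom_ext => a /=; rewrite fE /= mulr0 addr0.
by move=> a; rewrite -gmul_natural /= fE (iD _ _ _ _ x'E).
Qed.

Lemma left_invariant0 (G : algGroup k) : @left_invariant k G (fun=> 0).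
Proof.
move=> R g x x' x'E.
have -> : x' = alg_comp (@dual_in k R) x.
  by apply: alg_hom_ext => a; rewrite x'E /= rmorph0.
by move=> a; rewrite -gmul_natural /= rmorph0.
Qed.

Lemma left_invariantP (G : algGroup k) (c : k) (D E : coord G -> coord G) :
  derivation *%R D -> left_invariant D ->
  derivation *%R E -> left_invariant E ->
  left_invariant (fun a => c *: D a + E a).
Proof.
move=> dD iD dE iE R g x x' x'E.
pose e : dual R := (0, 1); pose gx := alg_comp (@dual_in k R).
have e0 : e * e = 0.
  change ((0 * 0, 0 * 1 + 1 * 0) = (0, 0) :> R * R).
  by rewrite !mul0r mulr0 addr0.
have ce0 : (c *: e) * (c *: e) = 0.
  by rewrite -scalerAl -scalerAr e0 !scaler0.
have [y yE] := evolve_hom (gx _ x) dD ce0.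
have emul (u v : R) : e * ((u, v) : dual R) = (0, u).
  change ((0 * u, 0 * v + 1 * u) = (0, u)).
  by rewrite !mul0r mul1r add0r.
have emulc (u v : R) : (c *: e) * ((u, v) : dual R) = (0, c *: u).
  rewrite -scalerAl emul; change ((c *: 0, c *: u) = (0, c *: u) :> R * R).
  by rewrite scaler0.
have ece0 : e * (c *: e) = 0 by rewrite -scalerAr e0 scaler0.
have ev (z : alg_hom (coord G) R) a :
    (gx _ z a + (c *: e) * gx _ z (D a))
     + e * (gx _ z (E a) + (c *: e) * gx _ z (D (E a)))
    = (z a, z (c *: D a + E a)).
  rewrite mulrDr mulrA ece0 mul0r addr0 emulc emul.
  change ((z a + 0 + 0, 0 + c *: z (D a) + z (E a)) =
    (z a, z (c *: D a + E a))).
  by rewrite !addr0 add0r linearP.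
have x'y a : x' a = y a + e * y (E a) by rewrite x'E !yE ev.
move=> a; rewrite (left_invariant_evolve _ dE iE e0 x'y).
rewrite !(left_invariant_evolve _ dD iD ce0 yE).
by rewrite -!gmul_natural ev.
Qed.

Lemma left_invariant_commutator (G : algGroup k) (D E : coord G -> coord G) :
  derivation *%R D -> left_invariant D ->
  derivation *%R E -> left_invariant E ->
  left_invariant (commutator D E).
Proof.
move=> dD iD dE iE R g x x' x'E.
pose S : comAlgType k := dual (dual R).
pose e1 : S := ((0, 1), (0, 0)); pose e2 : S := ((0, 0), (1, 0)).
have pairE (a b c d a' b' c' d' : R) :
    (((a, b), (c, d)) : S) * ((a', b'), (c', d')) =
    ((a * a', a * b' + b * a'),
     (a * c' + c * a', (a * d' + b * c') + (c * b' + d * a'))) by [].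
have e10 : e1 * e1 = 0.
  by rewrite pairE !mul0r !mulr0 !addr0.
have e20 : e2 * e2 = 0.
  by rewrite pairE !mul0r !mulr0 !addr0.
have e12 : e1 * e2 = ((0, 0), (0, 1)).
  by rewrite pairE !mul0r !mulr0 !mul1r !addr0 !add0r.
have ne10 : (- e1) * (- e1) = 0 by rewrite mulrNN.
have ne20 : (- e2) * (- e2) = 0 by rewrite mulrNN.
pose i (A : comAlgType k) (z : alg_hom A R) : alg_hom A S :=
  alg_comp (@dual_in k (dual R)) (alg_comp (@dual_in k R) z).
have ev (z : alg_hom (coord G) R) a :
    i _ z a + e1 * e2 * (i _ z (D (E a)) - i _ z (E (D a))) =
    ((z a, 0), (0, z (commutator D E a))).
  rewrite e12.
  have -> : i _ z (D (E a)) - i _ z (E (D a)) = i _ z (commutator D E a).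
    by rewrite /commutator rmorphB.
  have -> : i _ z (commutator D E a) =
      (((z (commutator D E a), 0 : R), (0 : R, 0 : R)) : S) by [].
  rewrite pairE !mul0r !addr0 !add0r mul1r.
  change (((z a + 0, 0 + 0 : R), (0 + 0 : R, 0 + z (commutator D E a))) =
    ((z a, 0), (0, z (commutator D E a))) :> S).
  by rewrite !addr0 add0r.
have [y1 y1E] := evolve_hom (i _ x) dD e10.
have [y2 y2E] := evolve_hom y1 dE e20.
have [y3 y3E] := evolve_hom y2 dD ne10.
have [y4 y4E] := evolve_hom y3 dE ne20.
have [h hE] : exists h : alg_hom (dual R) S,
    forall r, h r = ((r.1, 0), (0, r.2)).
  apply: alg_hom_build => [a u v|].
    change (((a *: u.1 + v.1, 0), (0, a *: u.2 + v.2)) =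
      ((a *: u.1 + v.1, a *: 0 + 0), (a *: 0 + 0, a *: u.2 + v.2)) :> S).
    by rewrite scaler0 addr0.
  split=> // u v; rewrite pairE !mul0r !mulr0 !addr0 !add0r.
  by [].
have x'y : alg_comp h x' = y4.
  apply: alg_hom_ext => a; rewrite /= hE x'E y4E !y3E !y2E !y1E.
  by rewrite commutator_expansion // ev.
move=> a.
have : alg_comp h (gmul (alg_comp (@dual_in k R) g) x') a =
    ((gmul g x a, 0), (0, gmul g x (commutator D E a))).
  rewrite gmul_natural x'y.
  have -> : alg_comp h (alg_comp (@dual_in k R) g) = i _ g.
    by apply: alg_hom_ext => b /=; rewrite hE.
  rewrite (left_invariant_evolve _ dE iE ne20 y4E).
  rewrite !(left_invariant_evolve _ dD iD ne10 y3E).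
  rewrite !(left_invariant_evolve _ dE iE e20 y2E).
  rewrite !(left_invariant_evolve _ dD iD e10 y1E).
  by rewrite commutator_expansion // -ev -!gmul_natural.
by rewrite /= hE; case: (gmul _ x' a) => u v [-> ->].
Qed.
End Evolve.


Section LieAlgGroup.
Context (k : fieldType) (G : algGroup k).

Definition left_invariant_derivation (D : coord G -> coord G) : Prop :=
  derivation *%R D /\ left_invariant D.

Let lid_linear D : left_invariant_derivation D -> linear D.
Proof. by case=> -[]. Qed.

Let lid0 : left_invariant_derivation (fun=> 0).
Proof.
by split; [exact: (derivation0 (@alg_mul k (coord G)))|exact: left_invariant0].
Qed.

Let lidP (a : k) D E :
  left_invariant_derivation D -> left_invariant_derivation E ->
  left_invariant_derivation (fun x => a *: D x + E x).
Proof.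
move=> [dD iD] [dE iE]; split; last exact: left_invariantP.
exact: (@derivationP _ _ (@alg_mul k (coord G))).
Qed.

Let lid_commutator D E :
  left_invariant_derivation D -> left_invariant_derivation E ->
  left_invariant_derivation (commutator D E).
Proof.
move=> [dD iD] [dE iE]; split; last exact: left_invariant_commutator.
exact: (@derivation_commutator _ _ (@alg_mul k (coord G))).
Qed.

Definition Lie : lieAlgType k :=
  lie_of (LieSubalgebra lid_linear lid0 lidP lid_commutator).
End LieAlgGroup.

(* Main.v *)
(* Let O(G) be the coordinate ring of G.  A left invariant derivation D of O(G)
   is determined by the point derivation eps o D at the identity.  Products of
   matrix coefficients of a generating finite-dimensional representation span an
   increasing sequence V_0, V_1, ... of finite-dimensional subspaces with union
   O(G) and V_(n+1) = V_n V_n.  The functionals on V_0 that extend to a point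
   derivation on V_n decrease with n, hence are constant from some n = d on, and
   Lie(G) is the Lie algebra of the endomorphisms of V_d + V_(d+1) that respect
   the product V_d x V_d -> V_(d+1), the inclusion V_d -> V_(d+1) and the left
   translations (l (x) id) o Delta of V_d.  Finitely many operators phi_i on an
   algebra M are encoded by adjoining idempotents e_i that act on M as phi_i,
   together with a unit e of the e_i such that e M = M e = 0: every derivation
   of the larger algebra kills e and the e_i, and preserves M.

   Conversely, Der(A) is the Lie algebra of the group scheme Aut(A), because
   1 + eps d is an automorphism over the dual numbers exactly when d is a
   derivation. *)

From HB Require Import structures.
Require Import Defs.
From mathcomp Require Import all_boot all_order all_algebra.
From mathcomp Require Import sesquilinear ring ring_quotient generic_quotient.
From mathcomp Require Import boolp classical_sets functions.
From mathcomp Require Import -(notations) mpoly.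

Set Implicit Arguments.
Unset Strict Implicit.
Unset Printing Implicit Defensive.

Import GRing.Theory VectorInternalTheory.
Local Open Scope ring_scope.

(** The obstacle is that O(G) is in general infinite-dimensional, and that a finite-dimensional
    subspace generating it need not be closed under products. Hence a derivation is seen only
    through the truncated product V_d x V_d -> V_(d+1), and a map that respects this product might
    not come from O(G); the stabilisation of point derivations removes that danger. The left
    translations are imposed because an endomorphism E that commutes with them is recovered from eps
    o E: the coordinates of E x are the values of eps o E at finitely many translates of x. The
    projection of V_d + V_(d+1) onto V_d is one more operator to adjoin; it makes E act on the two
    summands separately. As the group law is given on points only, the comultiplication is obtained
    as the product of the two universal points of G in O(G) (x) O(G), and coassociativity, counit
    laws and invariance are all exploited by evaluation at well-chosen points. *)

Lemma linear_build (k : fieldType) (U V : lmodType k) (f : U -> V) :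
  linear f -> exists g : {linear U -> V}, forall x, g x = f x.
Proof.
move=> lf; pose L := GRing.isLinear.Build k U V *:%R f lf.
pose g : {linear U -> V} := HB.pack f L.
by exists g.
Qed.

Lemma bilinear_build (k : fieldType) (U V W : lmodType k) (f : U -> V -> W) :
  (forall v, linear (f^~ v)) -> (forall u, linear (f u)) ->
  exists g : {bilinear U -> V -> W}, forall u v, g u v = f u v.
Proof.
move=> fl fr.
pose L := bilinear_isBilinear.Build k U V W *:%R *:%R f (conj fl fr).
pose g : {bilinear U -> V -> W} := HB.pack f L.
by exists g.
Qed.

Lemma inj_surj_bijective (T U : Type) (f : T -> U) :
  injective f -> (forall y, exists x, f x = y) -> bijective f.
Proof.
move=> finj fsurj; exists (fun y => sval (cid (fsurj y))) => [x|y].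
  by apply: finj; case: cid.
by case: cid.
Qed.

Lemma lie_isomorphic_build (k : fieldType) (g h : lieAlgType k) (f : g -> h) :
  linear f -> injective f -> (forall y, exists x, f x = y) ->
  (forall x y, f (lie_bracket x y) = lie_bracket (f x) (f y)) ->
  lie_isomorphic g h.
Proof.
move=> lf finj fsurj fb; have [f' f'E] := linear_build lf.
have {f'E} ff : f = f' by apply/funext => x; rewrite f'E.
by subst f; exists f' => //; exact: inj_surj_bijective.
Qed.

Lemma lie_isomorphic_trans (k : fieldType) (g h l : lieAlgType k) :
  lie_isomorphic g h -> lie_isomorphic h l -> lie_isomorphic g l.
Proof.
move=> [f fb fl] [f' fb' fl']; exists (f' \o f); first exact: bij_comp.
by move=> x y /=; rewrite fl fl'.
Qed.

(** * Linear functionals and free families in spaces of any dimension *)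

Section Functionals.
Context (k : fieldType) (V : lmodType k).

(** Zorn's lemma gives a subspace H maximal among those that contain U and miss v. Every x is then t
    v modulo H for a unique t, which is the value of the functional. *)
Lemma separating_functional (U : V -> Prop) (v : V) :
  U 0 -> (forall a x y, U x -> U y -> U (a *: x + y)) -> ~ U v ->
  exists2 l : {linear V -> k^o}, (forall x, U x -> l x = 0) & l v = 1.
Proof.
move=> U0 Ulin Uv.
(* The last clause says that H is empty or contains U: the empty set has to satisfy [P], being the
   union of the empty chain. *)
pose P (H : set V) := [/\ forall a x y, H x -> H y -> H (a *: x + y),
  ~ H v & forall x, H x -> forall y, U y -> H y].
have PU : P U by split.
have [F FP Ftot|H [[Hlin Hv HU] Hmax]] := @Zorn_bigcup V P.
  split.
  - move=> a x y [X FX Xx] [Y FY Yy].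
    have [XY|YX] := Ftot _ _ FX FY.
    + by exists Y => //; have [YL _ _] := FP _ FY; apply: YL => //; apply: XY.
    + by exists X => //; have [XL _ _] := FP _ FX; apply: XL => //; apply: YX.
  - by move=> [X FX Xv]; have [_ /(_ Xv)] := FP _ FX.
  - move=> x [X FX Xx] y Uy; exists X => //.
    by have [_ _ XU] := FP _ FX; apply: XU Xx _ Uy.
have UH x : U x -> H x.
  have [[z Hz]|Hn] := pselect (exists z, H z); first by apply: HU Hz _.
  exfalso; apply: (Hmax U) => //; split=> [z Hz|UH]; first by case: Hn; exists z.
  by apply: Hn; exists 0; apply: UH.
have H0 := UH _ U0.
have HZ a x : H x -> H (a *: x) by move=> Hx; rewrite -[_ *: _]addr0; apply: Hlin.
have HB x y : H x -> H y -> H (x - y).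
  by move=> Hx Hy; rewrite addrC -scaleN1r; apply: Hlin.
have dec x : exists t : k, H (x - t *: v).
  have [Hx|Hx] := pselect (H x); first by exists 0; rewrite scale0r subr0.
  (* [H'] is H + k x. Maximality of H forces v into it, and then t is nonzero because v is not in
     H. *)
  pose H' : set V := fun y => exists t, H (y - t *: x).
  have [t Ht] : H' v.
    apply: contrapT => Hv'; apply: (Hmax H').
      split=> [y Hy|/(_ x) H'H]; first by exists 0; rewrite scale0r subr0.
      by apply/Hx/H'H; exists 1; rewrite scale1r subrr.
    split=> // [a y z [t Ht] [u Hu]|y _ z Uz].
      exists (a * t + u); rewrite scalerDl opprD addrACA -scalerA -scalerBr.
      exact: Hlin.
    by exists 0; rewrite scale0r subr0; apply: UH.
  have t0 : t != 0.
    by apply/eqP => t0; apply: Hv; move: Ht; rewrite t0 scale0r subr0.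
  exists t^-1; suff -> : x - t^-1 *: v = - t^-1 *: (v - t *: x) by apply: HZ.
  by rewrite scalerBr scalerA mulNr mulVf // !scaleNr scale1r opprK addrC.
pose l x := sval (cid (dec x)).
have lH x : H (x - l x *: v) by rewrite /l; case: cid.
have lU x t : H (x - t *: v) -> l x = t.
  move=> Ht; apply/eqP; rewrite -subr_eq0; apply/negPn/negP => n0; apply: Hv.
  have := HZ (l x - t)^-1 _ (HB _ _ Ht (lH x)).
  rewrite [x - _]addrC addrKA opprK [- _ + _]addrC -scalerBl.
  by rewrite scalerA mulVf // scale1r.
have ll : linear (l : V -> k^o).
  move=> a x y; apply: lU.
  rewrite scalerDl opprD addrACA -scalerA -scalerBr.
  exact: Hlin.
have [f fE] := linear_build ll; exists f => [x /UH Hx|].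
  by rewrite fE; apply: lU; rewrite scale0r subr0.
by rewrite fE; apply: lU; rewrite scale1r subrr.
Qed.

Definition in_span (I : finType) (w : I -> V) (x : V) : Prop :=
  exists c : I -> k, x = \sum_i c i *: w i.

Definition free_family (I : finType) (w : I -> V) : Prop :=
  forall c : I -> k, \sum_i c i *: w i = 0 -> forall i, c i = 0.

Lemma in_span_lin (I : finType) (w : I -> V) a x y :
  in_span w x -> in_span w y -> in_span w (a *: x + y).
Proof.
move=> [c ->] [d ->]; exists (fun i => a * c i + d i).
rewrite scaler_sumr -big_split; apply: eq_bigr => i _.
by rewrite scalerDl scalerA.
Qed.

Lemma in_span0 (I : finType) (w : I -> V) : in_span w 0.
Proof.
by exists (fun=> 0); rewrite big1 // => i _; rewrite scale0r.
Qed.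

Lemma in_span_mem (I : finType) (w : I -> V) i : in_span w (w i).
Proof.
exists (fun j => (j == i)%:R); rewrite (bigD1 i) //= eqxx scale1r big1 ?addr0 //.
by move=> j /negPf ->; rewrite scale0r.
Qed.

Lemma in_span_sum (I J : finType) (w : I -> V) (c : J -> k) (v : J -> V) :
  (forall j, in_span w (v j)) -> in_span w (\sum_j c j *: v j).
Proof.
move=> wv; elim/big_rec: _ => [|j x _ wx]; first exact: in_span0.
exact: in_span_lin.
Qed.

Lemma in_span_trans (I J : finType) (w : I -> V) (v : J -> V) x :
  (forall j, in_span w (v j)) -> in_span v x -> in_span w x.
Proof. by move=> wv [c ->]; apply: in_span_sum. Qed.

(** Each w i lies outside the span of the other members, so a functional can kill those and be 1 at
    w i. *)
Lemma dual_functionals (I : finType) (w : I -> V) : free_family w ->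
  exists l : I -> {linear V -> k^o}, forall i j, l i (w j) = (i == j)%:R.
Proof.
move=> wfree.
have sep i : exists l : {linear V -> k^o}, forall j, l (w j) = (i == j)%:R.
  pose U x := exists2 c : I -> k, c i = 0 & x = \sum_j c j *: w j.
  have [|||l lU l1] := @separating_functional U (w i).
  - by exists (fun=> 0) => //; rewrite big1 // => j _; rewrite scale0r.
  - move=> a x y [c ci ->] [d di ->]; exists (fun i => a * c i + d i).
      by rewrite ci di mulr0 addr0.
    rewrite scaler_sumr -big_split; apply: eq_bigr => j _.
    by rewrite scalerDl scalerA.
  - move=> [c ci wi]; have /wfree/(_ i) : \sum_j (c j - (j == i)%:R) *: w j = 0.
      rewrite (eq_bigr (fun j => c j *: w j - (j == i)%:R *: w j)); last first.
        by move=> j _; rewrite scalerBl.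
      rewrite sumrB -wi (bigD1 i) //= eqxx scale1r big1 ?addr0 ?subrr //.
      by move=> j /negPf ->; rewrite scale0r.
    by rewrite ci eqxx sub0r => /eqP; rewrite oppr_eq0 oner_eq0.
  exists l => j; have [<-|ij] := eqVneq i j; first exact: l1.
  apply: lU; exists (fun l => (l == j)%:R); first by rewrite (negPf ij).
  rewrite (bigD1 j) //= eqxx scale1r big1 ?addr0 // => m /negPf ->.
  by rewrite scale0r.
by exists (fun i => sval (cid (sep i))) => i j; case: cid.
Qed.

Lemma free_span_ord n (v : 'I_n -> V) : exists r (w : 'I_r -> V),
  free_family w /\ forall x, in_span w x <-> in_span v x.
Proof.
elim: n v => [|n IHn] v.
  by exists 0, v; split=> // c _ [].
have [r [w [wfree wspan]]] := IHn (v \o lift ord0).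
have vw x : in_span w x -> in_span v x.
  by move=> /wspan; apply: in_span_trans => j; apply: in_span_mem.
have wv j : in_span w (v (lift ord0 j)).
  by apply/wspan; exact: (in_span_mem (v \o lift ord0)).
have [w0|w0] := pselect (in_span w (v ord0)).
  exists r, w; split=> // x; split; first exact: vw.
  apply: in_span_trans => j; by case: (unliftP ord0 j) => [i ->|->].
exists r.+1, (fun i => oapp w (v ord0) (unlift ord0 i)); split=> [c|x].
  rewrite big_ord_recl unlift_none /=.
  under eq_bigr do rewrite liftK /=.
  move=> c0; have [c00|c00] := eqVneq (c ord0) 0.
    move: c0; rewrite c00 scale0r add0r => /wfree cl i.
    by case: (unliftP ord0 i) => [j ->|->].
  (* A relation in which v ord0 has a nonzero coefficient can be solved for v ord0, against [w0]. *)
  case: w0; exists (fun i => - ((c ord0)^-1 * c (lift ord0 i))).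
  move/eqP: c0; rewrite addr_eq0 => /eqP c0.
  apply: (scalerI c00); rewrite c0 scaler_sumr -sumrN.
  by apply: eq_bigr => i _; rewrite scalerA mulrN mulVKf // scaleNr.
split; apply: in_span_trans => j.
  case: (unlift ord0 j) => [i|] /=; last exact: in_span_mem.
  exact/vw/in_span_mem.
set w' := fun i => _.
case: (unliftP ord0 j) => [i ->|->].
  apply: in_span_trans (wv i) => m.
  by have := in_span_mem w' (lift ord0 m); rewrite {2}/w' liftK.
by have := in_span_mem w' ord0; rewrite {2}/w' unlift_none.
Qed.

Lemma free_span (I : finType) (v : I -> V) : exists r (w : 'I_r -> V),
  free_family w /\ forall x, in_span w x <-> in_span v x.
Proof.
pose v' (i : 'I_#|I|) := v (enum_val i).
have [r [w [wfree wspan]]] := free_span_ord v'.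
exists r, w; split=> // x; rewrite wspan; split; apply: in_span_trans => j.
  exact: in_span_mem.
by have := in_span_mem v' (enum_rank j); rewrite /v' enum_rankK.
Qed.
End Functionals.

(** * Tensor products of commutative algebras *)

Section Tensor.
Context (k : fieldType) (A R : comAlgType k).
Local Notation functional := {linear A -> k^o}.
Implicit Types (l : functional) (s t : seq (A * R)).

Definition slice s l : R := \sum_(p <- s) (l p.1 : k) *: p.2.

(* A (x) R, embedded in R^(dual of A) by contraction of the left factor. *)
Definition tensor_mem : {pred (functional -> R)} :=
  fun F => `[< exists s, F = slice s >].

Lemma slice_cat s t l : slice (s ++ t) l = slice s l + slice t l.
Proof. by rewrite /slice big_cat. Qed.

Lemma tensor_submod_closed : submod_closed tensor_mem.
Proof.
split=> [|a F G /asboolP[s ->] /asboolP[t ->]]; apply/asboolP.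
  by exists [::]; apply/funext => l; rewrite /slice big_nil.
exists ([seq (p.1, a *: p.2) | p <- s] ++ t); apply/funext => l.
rewrite slice_cat; congr (_ + _).
change (a *: slice s l = slice [seq (p.1, a *: p.2) | p <- s] l).
rewrite /slice big_map scaler_sumr; apply: eq_bigr => p _ /=.
by rewrite !scalerA mulrC.
Qed.

HB.instance Definition _ :=
  GRing.isSubmodClosed.Build k (functional -> R) tensor_mem tensor_submod_closed.

Record tensor := Tensor { tensor_fun :> functional -> R;
  tensorP : tensor_fun \in tensor_mem }.

HB.instance Definition _ := [isSub for tensor_fun].
HB.instance Definition _ := [Choice of tensor by <:].
HB.instance Definition _ := [SubChoice_isSubLmodule of tensor by <:].

Implicit Types F G H : tensor.

Lemma tensor_ext F G : (forall l, F l = G l) -> F = G.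
Proof. by move=> FG; apply/val_inj/funext. Qed.

Lemma slice_tensor s : slice s \in tensor_mem.
Proof. by apply/asboolP; exists s. Qed.

Definition pure_sum s : tensor := Tensor (slice_tensor s).

Lemma tensor_rep F : exists s, F = pure_sum s.
Proof.
by have /asboolP[s Fs] := tensorP F; exists s; apply/val_inj.
Qed.

Lemma pure_sumP s t :
  pure_sum s = pure_sum t <-> forall l, slice s l = slice t l.
Proof.
split=> [/(congr1 tensor_fun) /= + l|st]; first by move=> ->.
exact: tensor_ext.
Qed.

Definition seq_mul s t := [seq (p.1 * q.1, p.2 * q.2) | p <- s, q <- t].

Lemma seq_mulE s t l : slice (seq_mul s t) l =
  \sum_(p <- s) \sum_(q <- t) (l (p.1 * q.1) : k) *: (p.2 * q.2).
Proof. by rewrite /slice big_allpairs_dep. Qed.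

(** Multiplication by q.1 followed by l is again a functional, so the slices of s determine those of
    its products. This makes [tensor_mul] independent of the chosen representatives. *)
Lemma seq_mul_extl s s' t : (forall l, slice s l = slice s' l) ->
  forall l, slice (seq_mul s t) l = slice (seq_mul s' t) l.
Proof.
move=> ss' l; rewrite !seq_mulE exchange_big [RHS]exchange_big.
apply: eq_bigr => q _.
have /linear_build[l' l'E] : linear (fun x => l (x * q.1) : k^o).
  by move=> a x y; rewrite mulrDl -scalerAl linearP.
have aux u : \sum_(p <- u) (l (p.1 * q.1) : k) *: (p.2 * q.2) = slice u l' * q.2.
  by rewrite mulr_suml; apply: eq_bigr => p _; rewrite l'E scalerAl.
by rewrite !aux ss'.
Qed.

Lemma seq_mulC s t l : slice (seq_mul s t) l = slice (seq_mul t s) l.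
Proof.
rewrite !seq_mulE exchange_big; apply: eq_bigr => q _; apply: eq_bigr => p _.
by rewrite mulrC [p.2 * _]mulrC.
Qed.

Definition rep F := sval (cid (tensor_rep F)).

Lemma repK F : pure_sum (rep F) = F.
Proof. by rewrite /rep; case: cid. Qed.

Definition tensor_mul F G := pure_sum (seq_mul (rep F) (rep G)).

Lemma pure_sumM s t :
  tensor_mul (pure_sum s) (pure_sum t) = pure_sum (seq_mul s t).
Proof.
apply/pure_sumP => l.
have /pure_sumP rs := repK (pure_sum s); have /pure_sumP rt := repK (pure_sum t).
by rewrite (seq_mul_extl _ rs) seq_mulC (seq_mul_extl _ rt) seq_mulC.
Qed.

Lemma pure_sumD s t : pure_sum s + pure_sum t = pure_sum (s ++ t).
Proof. by apply: tensor_ext => l; rewrite [RHS]slice_cat. Qed.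

Lemma tensor_mulA : associative tensor_mul.
Proof.
move=> F G H; have [[[s ->] [t ->]] [u ->]] :=
  (tensor_rep F, tensor_rep G, tensor_rep H).
rewrite !pure_sumM; apply/pure_sumP => l.
rewrite /slice !big_allpairs_dep /=; apply: eq_bigr => p _.
rewrite big_allpairs_dep /=; apply: eq_bigr => q _; apply: eq_bigr => r _.
by rewrite !mulrA.
Qed.

Lemma tensor_mulC : commutative tensor_mul.
Proof.
move=> F G; have [[s ->] [t ->]] := (tensor_rep F, tensor_rep G).
by rewrite !pure_sumM; apply/pure_sumP => l; exact: seq_mulC.
Qed.

Definition tensor_one := pure_sum [:: (1, 1)].

Lemma tensor_mul1 : left_id tensor_one tensor_mul.
Proof.
move=> F; have [s ->] := tensor_rep F.
rewrite pure_sumM; apply/pure_sumP => l; rewrite seq_mulE big_seq1.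
by apply: eq_bigr => p _; rewrite !mul1r.
Qed.

Lemma tensor_mulDl : left_distributive tensor_mul +%R.
Proof.
move=> F G H; have [[[s ->] [t ->]] [u ->]] :=
  (tensor_rep F, tensor_rep G, tensor_rep H).
rewrite pure_sumD !pure_sumM pure_sumD; apply/pure_sumP => l.
by rewrite slice_cat !seq_mulE big_cat.
Qed.

Lemma tensor_one_neq0 : tensor_one != 0.
Proof.
have [|||l _ l1] := @separating_functional k A (eq^~ 0) 1.
- by [].
- by move=> a x y -> ->; rewrite scaler0 addr0.
- by apply/eqP/oner_neq0.
apply/eqP => /(congr1 (fun F => tensor_fun F l)) /=.
rewrite /slice big_seq1 /= l1 scale1r => /eqP.
by rewrite [_ == _]oner_eq0.
Qed.

HB.instance Definition _ := GRing.Zmodule_isComNzRing.Build tensor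
  tensor_mulA tensor_mulC tensor_mul1 tensor_mulDl tensor_one_neq0.

Lemma pure_sumZ a s : a *: pure_sum s = pure_sum [seq (p.1, a *: p.2) | p <- s].
Proof.
apply: tensor_ext => l; change (a *: slice s l =
  slice [seq (p.1, a *: p.2) | p <- s] l).
rewrite /slice big_map scaler_sumr; apply: eq_bigr => p _ /=.
by rewrite !scalerA mulrC.
Qed.

Lemma tensor_scaleAl (a : k) F G : a *: (F * G) = a *: F * G.
Proof.
have [[s ->] [t ->]] := (tensor_rep F, tensor_rep G).
change (a *: tensor_mul (pure_sum s) (pure_sum t) =
  tensor_mul (a *: pure_sum s) (pure_sum t)).
rewrite pure_sumM [in RHS]pure_sumZ pure_sumM pure_sumZ; apply/pure_sumP => l.
rewrite /slice big_map !big_allpairs_dep big_map; apply: eq_bigr => p _.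
by apply: eq_bigr => q _; rewrite /= scalerAl.
Qed.

HB.instance Definition _ :=
  GRing.Lmodule_isLalgebra.Build k tensor tensor_scaleAl.
HB.instance Definition _ := GRing.Lalgebra_isComAlgebra.Build k tensor.

(** All that is used of the tensor product from here on: the two universal points, contraction of
    the left factor, the universal property, and generation by pure tensors. *)
Lemma tensor_prod : exists (T : comAlgType k) (i : alg_hom A T) (j : alg_hom R T)
    (ev : functional -> {linear T -> R}),
  (forall l a r, ev l (i a * j r) = (l a : k) *: r) /\
  (forall (S : comAlgType k) (x : alg_hom A S) (y : alg_hom R S),
     exists h : alg_hom T S, alg_comp h i = x /\ alg_comp h j = y) /\
  (forall F : T, exists s, F = \sum_(p <- s) i p.1 * j p.2).
Proof.
exists tensor.
have [i iE] : exists i : alg_hom A tensor, forall a, i a = pure_sum [:: (a, 1)].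
  apply: alg_hom_build => [a u v|].
    rewrite pure_sumZ pure_sumD; apply/pure_sumP => l.
    rewrite /slice big_cat big_map !big_seq1 /= linearP scalerDl.
    by rewrite -[a *: l u]/(a * l u) mulrC -scalerA.
  split=> [//|u v]; rewrite [RHS]pure_sumM; apply/pure_sumP => l.
  by rewrite seq_mulE /slice !big_seq1 mulr1.
have [j jE] : exists j : alg_hom R tensor, forall r, j r = pure_sum [:: (1, r)].
  apply: alg_hom_build => [a u v|].
    rewrite pure_sumZ pure_sumD; apply/pure_sumP => l.
    by rewrite /slice big_cat !big_seq1 /= scalerDr.
  split=> [//|u v]; rewrite [RHS]pure_sumM; apply/pure_sumP => l.
  by rewrite seq_mulE /slice !big_seq1 mulr1.
have ijE a r : i a * j r = pure_sum [:: (a, r)].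
  rewrite iE jE [LHS]pure_sumM; apply/pure_sumP => l.
  by rewrite seq_mulE /slice !big_seq1 mulr1 mul1r.
have ijsE s : \sum_(p <- s) i p.1 * j p.2 = pure_sum s.
  elim: s => [|p s IHs]; last first.
    by rewrite big_cons IHs ijE pure_sumD -surjective_pairing.
  by rewrite big_nil; apply: tensor_ext => l; rewrite /= /slice big_nil.
have evlin l : exists e : {linear tensor -> R}, forall F, e F = F l.
  exact: linear_build.
pose ev l := sval (cid (evlin l)).
have evE l F : ev l F = F l by rewrite /ev; case: cid.
exists i, j, ev; split; last split.
- by move=> l a r; rewrite evE ijE /= /slice big_seq1.
- move=> S x y; pose h F := \sum_(p <- rep F) x p.1 * y p.2.
  (* [h] is computed on a chosen representative, so it must depend on slices only. Expanding the
     left factors of s and t in one free family w expresses both sums through the slices at the dual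
     functionals [d m]. *)
  have hext s t : (forall l, slice s l = slice t l) ->
      \sum_(p <- s) x p.1 * y p.2 = \sum_(p <- t) x p.1 * y p.2.
    move=> st; pose v (i : 'I_(size (s ++ t))) := (nth 0 (s ++ t) i).1.
    have [r [w [wfree wv]]] := free_span v.
    have [d dE] := dual_functionals wfree.
    have expand u : {subset u <= s ++ t} -> \sum_(p <- u) x p.1 * y p.2 =
        \sum_m x (w m) * y (slice u (d m)).
      move=> ust; under [RHS]eq_bigr do rewrite /slice linear_sum /= mulr_sumr.
      rewrite exchange_big !big_seq; apply: eq_bigr => p /ust pst.
      have /wv [c pc] : in_span v p.1.
        have ip : (index p (s ++ t) < size (s ++ t))%N by rewrite index_mem.
        by have := in_span_mem v (Ordinal ip); rewrite /v /= nth_index.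
      rewrite {1}pc linear_sum /= mulr_suml; apply: eq_bigr => m _.
      rewrite !linearZ /= -scalerAl -scalerAr; congr (_ *: _).
      rewrite pc linear_sum (bigD1 m) //= linearZ /= dE eqxx big1 => [|n mn].
        by rewrite addr0 [_ *: _]mulr1.
      by rewrite linearZ /= dE eq_sym (negPf mn) scaler0.
    rewrite !expand; first by apply: eq_bigr => m _; rewrite st.
      by move=> p; rewrite mem_cat => ->; rewrite orbT.
    by move=> p; rewrite mem_cat => ->.
  have hE s : h (pure_sum s) = \sum_(p <- s) x p.1 * y p.2.
    by apply/hext/pure_sumP; rewrite repK.
  have [h' h'E] : exists h' : alg_hom tensor S, forall F, h' F = h F.
    apply: alg_hom_build => [a F G|].
      have [[s ->] [t ->]] := (tensor_rep F, tensor_rep G).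
      rewrite pure_sumZ pure_sumD !hE big_cat; congr (_ + _).
      rewrite big_map scaler_sumr; apply: eq_bigr => p _ /=.
      by rewrite linearZ /= scalerAr.
    split=> [|F G]; first by rewrite hE big_seq1 !rmorph1 mulr1.
    have [[s ->] [t ->]] := (tensor_rep F, tensor_rep G).
    rewrite [_ * _]pure_sumM !hE big_allpairs_dep mulr_suml.
    apply: eq_bigr => p _; rewrite mulr_sumr; apply: eq_bigr => q _ /=.
    by rewrite !rmorphM mulrACA.
  exists h'; split; apply: alg_hom_ext => a /=.
    by rewrite h'E iE hE big_seq1 /= rmorph1 mulr1.
  by rewrite h'E jE hE big_seq1 /= rmorph1 mul1r.
- by move=> F; exists (rep F); rewrite ijsE repK.
Qed.
End Tensor.

(** * Matrix coefficients *)

Section Comultiplication.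
Context (k : fieldType) (G : algGroup k).
Local Notation A := (Defs.coord G).
Implicit Types (R S : comAlgType k).

Lemma gmulg1 R (x : alg_hom A R) : gmul x (gone G R) = x.
Proof.
have mulgV (y : alg_hom A R) : gmul y (ginv y) = gone G R.
  rewrite -[LHS]gmul1 -[X in gmul X _](gmulV (ginv y)).
  by rewrite -gmulA [gmul (ginv y) _]gmulA gmulV gmul1 gmulV.
by rewrite -(gmulV x) gmulA mulgV gmul1.
Qed.

(** The image of the unit is idempotent, and the only idempotent of a group is its unit. *)
Lemma gone_natural R S (f : alg_hom R S) : alg_comp f (gone G R) = gone G S.
Proof.
set e := alg_comp _ _.
have ee : gmul e e = e by rewrite -gmul_natural gmul1.
by rewrite -[LHS]gmul1 -(gmulV e) -gmulA ee.
Qed.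

Definition counit : alg_hom A k^o := gone G k^o.

Lemma goneE R a : gone G R a = (counit a : k) *: 1.
Proof.
have [f fE] : exists f : alg_hom k^o R, forall c, f c = c *: 1.
  apply: alg_hom_build => [c x y|]; first by rewrite scalerDl -scalerA.
  by split=> [|x y]; rewrite ?scale1r // -scalerAl mul1r scalerA.
by rewrite -(gone_natural f) /= fE.
Qed.

Definition alg_id R : alg_hom R R := idfun.

(** Stands for Delta(a) = sum of b_i (x) c_i, phrased at all pairs of points so that no tensor
    product has to be carried along. *)
Definition comul (I : finType) (b c : I -> A) (a : A) : Prop :=
  forall R (g x : alg_hom A R), gmul g x a = \sum_i g (b i) * x (c i).

(** Yoneda: the group law is evaluated at the pair of universal points, and any pair (g, x) is the
    image of that pair under some [h]. *)
Lemma comul_exists a : exists n (b c : 'I_n -> A), comul b c a.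
Proof.
have [T [i [j [ev [_ [Tuniv Tgen]]]]]] := tensor_prod A A.
have [s sE] := Tgen (gmul i j a).
exists (size s), (fun m => (s`_m).1), (fun m => (s`_m).2) => R g x.
have [h [<- <-]] := Tuniv _ g x.
rewrite -gmul_natural /= sE linear_sum (big_nth 0) big_mkord.
by apply: eq_bigr => m _; rewrite rmorphM.
Qed.

Lemma comul_counitr (I : finType) (b c : I -> A) a :
  comul b c a -> a = \sum_i (counit (c i) : k) *: b i.
Proof.
move=> abc; rewrite -[LHS]/(alg_id A a) -[alg_id A]gmulg1 abc.
by apply: eq_bigr => i _; rewrite goneE -scalerAr mulr1.
Qed.

Lemma comul_counitl (I : finType) (b c : I -> A) a :
  comul b c a -> a = \sum_i (counit (b i) : k) *: c i.
Proof.
move=> abc; rewrite -[LHS]/(alg_id A a) -[alg_id A]gmul1 abc.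
by apply: eq_bigr => i _; rewrite goneE -scalerAl mul1r.
Qed.

(** This is (l (x) id) o Delta. Contracting the product of the universal points shows that it is
    linear and independent of how Delta(a) is written. *)
Lemma left_slice (l : {linear A -> k^o}) : exists L : {linear A -> A},
  forall (I : finType) (b c : I -> A) a, comul b c a ->
    L a = \sum_i (l (b i) : k) *: c i.
Proof.
have [T [i [j [ev [evE _]]]]] := tensor_prod A A.
have /linear_build[L LE] : linear (fun a => ev l (gmul i j a)).
  by move=> u a b; rewrite !linearP.
exists L => I b c a abc; rewrite LE abc linear_sum; apply: eq_bigr => m _.
by rewrite evE.
Qed.

Lemma right_slice (l : {linear A -> k^o}) : exists L : {linear A -> A},
  forall (I : finType) (b c : I -> A) a, comul b c a ->
    L a = \sum_i (l (c i) : k) *: b i.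
Proof.
have [T [i [j [ev [evE _]]]]] := tensor_prod A A.
(* [ev] contracts only the factor embedded by [i], so the universal points are multiplied in the
   opposite order. *)
have /linear_build[L LE] : linear (fun a => ev l (gmul j i a)).
  by move=> u a b; rewrite !linearP.
exists L => I b c a abc; rewrite LE abc linear_sum; apply: eq_bigr => m _.
by rewrite mulrC evE.
Qed.

Definition comodule (I : finType) (b : I -> A) (M : I -> I -> A) : Prop :=
  forall j, comul b (M^~ j) (b j).

(** The matrix M is multiplicative on points: its value at gmul g x is the product of its values at
    g and at x. *)
Definition corep (I : finType) (M : I -> I -> A) : Prop :=
  forall i j, comul (M i) (M^~ j) (M i j).

Definition coefs (I : finType) (M : I -> I -> A) (p : I * I) : A := M p.1 p.2.

(* Write Delta(a) as a sum of b_j (x) w_j with independent w_j: coassociativity,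
   contracted with the functional dual to w_j, computes Delta(b_j). *)
Lemma in_comodule a : exists n (b : 'I_n -> A) (M : 'I_n -> 'I_n -> A),
  comodule b M /\ in_span b a.
Proof.
have [n [b0 [c0 abc0]]] := comul_exists a.
have [r [w [wfree wc0]]] := free_span c0.
have [d dE] := dual_functionals wfree.
have c0E i : c0 i = \sum_j (d j (c0 i) : k) *: w j.
  have /wc0 [c cE] := in_span_mem c0 i; rewrite [LHS]cE.
  apply: eq_bigr => j _; congr (_ *: _).
  rewrite cE linear_sum (bigD1 j) //= linearZ /= dE eqxx big1 => [|m mj].
    by rewrite addr0 [_ *: _]mulr1.
  by rewrite linearZ /= dE eq_sym (negPf mj) scaler0.
pose b j := \sum_i (d j (c0 i) : k) *: b0 i.
have abw : comul b w a.
  move=> R g x; rewrite abc0.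
  under eq_bigr do rewrite c0E linear_sum mulr_sumr.
  rewrite exchange_big; apply: eq_bigr => j _; rewrite linear_sum mulr_suml.
  by apply: eq_bigr => i _; rewrite !linearZ /= -scalerAl -scalerAr.
clearbody b.
have /choice[L LE] := fun j => right_slice (d j).
(* The entry is (id (x) d_j)(Delta(w_i)), which is what coassociativity produces after contraction
   with [d j]. *)
exists r, b, (fun i j => L j (w i)); split; last first.
  by rewrite (comul_counitr abw); exists (fun i => counit (w i) : k).
move=> j R g x.
(* The third point is the universal one in A (x) R, so the contraction touches its factor only and
   leaves g and x alone. *)
have [T [i [iR [ev [evE _]]]]] := tensor_prod A R.
have := congr1 (fun y : alg_hom A T => ev (d j) (y a))
  (gmulA (alg_comp iR g) (alg_comp iR x) i).
rewrite -gmul_natural !abw !linear_sum => /esym; rewrite (bigD1 j) //=.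
rewrite mulrC evE dE eqxx scale1r big1 ?addr0 => [->|m mj]; last first.
  by rewrite mulrC evE dE eq_sym (negPf mj) scale0r.
apply: eq_bigr => l _.
have [n' [p [q wpq]]] := comul_exists (w l).
rewrite wpq (LE _ _ _ _ _ wpq) mulr_sumr !linear_sum mulr_sumr.
apply: eq_bigr => m _ /=.
by rewrite mulrA mulrC -rmorphM evE linearZ /= -scalerAr.
Qed.

(** Independence of b is what permits the comparison of coefficients in [in_corep]. The matrix is
    transported by expressing the old and the new spanning family through each other. *)
Lemma in_free_comodule a : exists n (b : 'I_n -> A) (M : 'I_n -> 'I_n -> A),
  [/\ comodule b M, free_family b & in_span b a].
Proof.
have [n [b [M [bM ab]]]] := in_comodule a.
have [r [w [wfree wb]]] := free_span b.
have /choice[c cE] : forall i, exists c : 'I_n -> k, w i = \sum_j c j *: b j.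
  by move=> i; apply/wb/in_span_mem.
have /choice[d dE] : forall i, exists d : 'I_r -> k, b i = \sum_j d j *: w j.
  by move=> i; apply/wb/in_span_mem.
exists r, w, (fun m j => \sum_i \sum_l (c j i * d l m) *: M l i); split=> //.
  move=> j R g x; rewrite cE linear_sum /=.
  under eq_bigr do rewrite linearZ /= bM.
  under [RHS]eq_bigr do rewrite linear_sum mulr_sumr.
  rewrite [RHS]exchange_big; apply: eq_bigr => i _ /=.
  under [RHS]eq_bigr do rewrite linear_sum mulr_sumr.
  rewrite [RHS]exchange_big scaler_sumr; apply: eq_bigr => l _ /=.
  rewrite dE linear_sum mulr_suml scaler_sumr; apply: eq_bigr => m _ /=.
  by rewrite !linearZ /= -scalerAl -scalerAr scalerA.
exact/wb.
Qed.

(** Comparing coefficients of the free family b in the two expansions of the iterated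
    comultiplication of b_j shows that M is multiplicative. The counit law b_j = sum_i eps(b_i) M_ij
    puts the comodule inside the span of the coefficients. *)
Lemma in_corep a : exists n (M : 'I_n -> 'I_n -> A),
  corep M /\ in_span (coefs M) a.
Proof.
have [n [b [M [bM bfree ab]]]] := in_free_comodule a.
exists n, M; split; last first.
  apply: in_span_trans ab => j.
  rewrite (comul_counitl (bM j)); apply: in_span_sum => i.
  exact: (in_span_mem (coefs M) (i, j)).
have [d dE] := dual_functionals bfree.
move=> l j R x y.
have [T [i [iR [ev [evE _]]]]] := tensor_prod A R.
have := congr1 (fun z : alg_hom A T => ev (d l) (z (b j)))
  (gmulA i (alg_comp iR x) (alg_comp iR y)).
rewrite -gmul_natural !bM !linear_sum (bigD1 l) //= evE dE eqxx scale1r.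
rewrite big1 ?addr0 => [->|m ml]; last first.
  by rewrite evE dE eq_sym (negPf ml) scale0r.
apply: eq_bigr => m _.
rewrite bM mulr_suml linear_sum (bigD1 l) //= big1 ?addr0 => [|p pl].
  by rewrite -mulrA -rmorphM evE dE eqxx scale1r.
by rewrite -mulrA -rmorphM evE dE eq_sym (negPf pl) scale0r.
Qed.

Lemma in_corep_seq (s : seq A) : exists (I : finType) (M : I -> I -> A),
  corep M /\ forall a, a \in s -> in_span (coefs M) a.
Proof.
elim: s => [|a s [I [M [cM sM]]]].
  by exists void, (fun=> fun=> 0); split=> [[]|a].
have [n [N [cN aN]]] := in_corep a.
(* The block diagonal sum of the two representations. *)
pose P (i j : ('I_n + I)%type) : A := match i, j with
  | inl i, inl j => N i j
  | inr i, inr j => M i j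
  | _, _ => 0
  end.
exists ('I_n + I)%type, P; split.
  move=> [i|i] [j|j] R g x; rewrite big_sumType /= ?cM ?cN ?linear0.
  - by rewrite [X in _ + X]big1 ?addr0 // => l _; rewrite ?linear0 mul0r.
  - by rewrite !big1 ?addr0 // => l _; rewrite ?linear0 ?mul0r ?mulr0.
  - by rewrite !big1 ?addr0 // => l _; rewrite ?linear0 ?mul0r ?mulr0.
  - by rewrite [X in X + _]big1 ?add0r // => l _; rewrite ?linear0 mul0r.
move=> u; rewrite inE => /orP[/eqP ->|/sM]; [apply: in_span_trans aN|];
  [|apply: in_span_trans] => -[i j].
  exact: (in_span_mem (coefs P) (inl i, inl j)).
exact: (in_span_mem (coefs P) (inr i, inr j)).
Qed.
End Comultiplication.

(** * Left invariant derivations and point derivations *)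

Section InvariantDerivations.
Context (k : fieldType) (G : algGroup k).
Local Notation A := (Defs.coord G).
Local Notation eps := (counit G).

Definition point_derivation (l : {linear A -> k^o}) : Prop :=
  forall a b, l (a * b) = l a * eps b + eps a * l b.

Lemma dual_pairE (R : comAlgType k) (I : finType) (u v w : I -> R) :
  \sum_i dual_in (u i) * ((v i, w i) : dual R) =
  (\sum_i u i * v i, \sum_i u i * w i) :> dual R.
Proof.
elim/big_rec3: _ => [//|i x y z _ ->].
by congr (_, _); rewrite /= mul0r addr0.
Qed.

(** D is (id (x) (eps o D)) o Delta: invariance is applied to the tangent vector of D at the
    identity, translated by the generic point [alg_id A]. *)
Lemma left_invariant_slice (D : A -> A) (I : finType) (b c : I -> A) a :
  left_invariant_derivation D -> comul b c a ->
  D a = \sum_i (eps (D (c i)) : k) *: b i.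
Proof.
move=> [[Dlin Dmul] Dinv] abc; have D1 := derivation1 (conj Dlin Dmul).
pose x := gone G A.
have [x' x'E] : exists x' : alg_hom A (dual A), forall a, x' a = (x a, x (D a)).
  apply: alg_hom_build => [t u v|]; first by rewrite Dlin !linearP.
  split=> [|u v]; first by rewrite D1 rmorph0 rmorph1.
  rewrite Dmul rmorphD !rmorphM; congr (_, _).
  by rewrite addrC.
have := Dinv A (alg_id A) x x' x'E a.
rewrite abc; under eq_bigr do rewrite x'E.
rewrite dual_pairE gmulg1 => -[_ <-]; apply: eq_bigr => i _.
by rewrite goneE -scalerAr mulr1.
Qed.

(** The derivation is (id (x) l) o Delta. Its Leibniz rule comes from multiplicativity of Delta and
    the counit law. Invariance is linear in a, so it is checked on matrix coefficients, where Delta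
    is explicit. *)
Lemma left_invariant_of_point (l : {linear A -> k^o}) : point_derivation l ->
  exists D : {linear A -> A}, [/\ left_invariant_derivation D,
    forall a, eps (D a) = l a &
    forall (I : finType) (b c : I -> A) a, comul b c a ->
      D a = \sum_i (l (c i) : k) *: b i].
Proof.
move=> ld; have [D DE] := right_slice l.
exists D; split=> //; last first.
  move=> a; have [n [b [c abc]]] := comul_exists a.
  rewrite (DE _ _ _ _ abc) [in RHS](comul_counitl abc) !linear_sum.
  by apply: eq_bigr => i _; rewrite !linearZ /= [LHS]mulrC.
split.
  split=> [|a a']; first exact: linearP.
  have [n [b [c abc]]] := comul_exists a.
  have [n' [b' [c' abc']]] := comul_exists a'.
  have aabc : comul (fun p : 'I_n * 'I_n' => b p.1 * b' p.2)
      (fun p => c p.1 * c' p.2) (a * a').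
    move=> R g x; rewrite [LHS]rmorphM /= abc abc' mulr_suml.
    under [LHS]eq_bigr do rewrite mulr_sumr.
    rewrite pair_bigA; apply: eq_bigr => p _.
    by rewrite !rmorphM mulrACA.
  rewrite (DE _ _ _ _ aabc) (DE _ _ _ _ abc) (DE _ _ _ _ abc').
  rewrite [in RHS](comul_counitr abc) [X in _ * X + _](comul_counitr abc').
  rewrite !mulr_suml -big_split -(pair_bigA _ (fun i j =>
    (l (c i * c' j) : k) *: (b i * b' j))) /=; apply: eq_bigr => i _.
  rewrite !mulr_sumr -big_split; apply: eq_bigr => j _ /=.
  rewrite ld scalerDl -!scalerAl -!scalerAr !scalerA.
  by congr (_ + _).
move=> R g x x' x'E a.
have [n [M [cM [c ->]]]] := in_corep a.
suff H p : gmul (alg_comp (@dual_in k R) g) x' (coefs M p) =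
    (gmul g x (coefs M p), gmul g x (D (coefs M p))).
  elim/big_rec: _ => [|p y _ yE]; first by rewrite !linear0.
  by rewrite !linearP /= H yE.
case: p => i j; rewrite /coefs /= !cM.
under eq_bigr do rewrite x'E.
rewrite dual_pairE; congr (_, _); rewrite (DE _ _ _ _ (cM i j)) linear_sum.
under [RHS]eq_bigr do rewrite linearZ /= cM scaler_sumr.
rewrite [RHS]exchange_big; apply: eq_bigr => m _.
rewrite (DE _ _ _ _ (cM m j)) linear_sum mulr_sumr; apply: eq_bigr => m' _.
by rewrite linearZ /= -scalerAr.
Qed.
End InvariantDerivations.

(** * Filtration by finite-dimensional subcoalgebras *)

(** A subspace of largest dimension inside P exhausts it, since adjoining a missing vector would
    raise the dimension. *)
Lemma submodule_vspace (k : fieldType) (U : vectType k) (P : U -> Prop) :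
  P 0 -> (forall a x y, P x -> P y -> P (a *: x + y)) ->
  exists W : {vspace U}, forall x, P x <-> x \in W.
Proof.
move=> P0 Plin.
pose Q n := `[< exists2 W : {vspace U}, \dim W = n & forall x, x \in W -> P x >].
have Q0 : exists n, Q n.
  exists 0; apply/asboolP; exists 0%VS; first exact: dimv0.
  by move=> x; rewrite memv0 => /eqP ->.
have Qb n : Q n -> (n <= \dim {:U})%N.
  by move=> /asboolP[W <- _]; apply/dimvS/subvf.
case: (ex_maxnP Q0 Qb) => d /asboolP[W Wd WP] dmax; exists W => x.
split=> [Px|/WP //]; apply: contrapT => Wx.
have /dmax : Q (\dim (W + <[x]>)%VS).
  apply/asboolP; exists (W + <[x]>)%VS => // y /memv_addP[w ww [z /vlineP[c ->] ->]].
  by rewrite addrC; apply: Plin => //; apply: WP.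
rewrite -Wd => le; apply: Wx; rewrite memvE.
have /eqP -> : W == (W + <[x]>)%VS.
  by rewrite eqEdim addvSl.
exact: addvSr.
Qed.

(** The index d is a stage at which the dimension is least. *)
Lemma descending_chain (k : fieldType) (U : vectType k) (P : nat -> U -> Prop) :
  (forall n, P n 0) ->
  (forall n a x y, P n x -> P n y -> P n (a *: x + y)) ->
  (forall n x, P n.+1 x -> P n x) ->
  exists d, forall n x, P d x -> P n x.
Proof.
move=> P0 Plin Pdec.
have /choice[W WE] := fun n => submodule_vspace (P0 n) (Plin n).
have Wmono m n : (m <= n)%N -> (W n <= W m)%VS.
  elim: n => [|n IHn]; first by rewrite leqn0 => /eqP ->.
  rewrite leq_eqVlt => /predU1P[-> //|/IHn]; apply: subv_trans.
  by apply/subvP => x /WE /Pdec /WE.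
have exD : exists m, `[< exists n, \dim (W n) = m >].
  by exists (\dim (W 0)); apply/asboolP; exists 0.
case: (ex_minnP exD) => m /asboolP[d dm] mmin; exists d => n x /WE xd; apply/WE.
have [/Wmono/subvP -> //|/ltnW/Wmono nd] := leqP n d.
have /eqP -> // : W n == W d.
by rewrite eqEdim nd dm mmin //; apply/asboolP; exists n.
Qed.

Section Tower.
Context (k : fieldType) (G : algGroup k).
Local Notation A := (Defs.coord G).
Local Notation eps := (counit G).
Context (I : finType) (M : I -> I -> A).
Hypotheses (Mcorep : corep M) (M1 : in_span (coefs M) 1).
Hypothesis Mgen : forall S : {pred A},
  GRing.subalg_closed S -> (forall p, coefs M p \in S) -> forall a, a \in S.

Fixpoint tower_index n : finType :=
  if n is m.+1 then (tower_index m * tower_index m)%type else I.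

(** Each stage is the tensor square of the previous representation. Its coefficients are the
    products of two earlier ones, so every V_n is the coefficient space of a single [corep]. *)
Fixpoint tower n : tower_index n -> tower_index n -> A :=
  match n with
  | 0 => M
  | m.+1 => fun p q => tower p.1 q.1 * tower p.2 q.2
  end.

Definition tower_span n : A -> Prop := in_span (coefs (@tower n)).

Lemma tower_corep n : corep (@tower n).
Proof.
elim: n => //= n IHn [i i'] [j j'] R g x /=.
rewrite [LHS]rmorphM /= !IHn mulr_suml.
under [LHS]eq_bigr do rewrite mulr_sumr.
rewrite pair_bigA; apply: eq_bigr => p _.
by rewrite !rmorphM mulrACA.
Qed.

Lemma tower_spanM n x y :
  tower_span n x -> tower_span n y -> tower_span n.+1 (x * y).
Proof.
move=> [c ->] [d ->]; rewrite mulr_suml.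
under eq_bigr do rewrite -scalerAl.
apply: in_span_sum => p; rewrite mulr_sumr.
under eq_bigr do rewrite -scalerAr.
apply: in_span_sum => q.
by have := in_span_mem (coefs (@tower n.+1)) ((p.1, q.1), (p.2, q.2)).
Qed.

Lemma tower_span1 n : tower_span n 1.
Proof. by elim: n => // n IHn; rewrite -[1]mulr1; apply: tower_spanM. Qed.

Lemma tower_spanS n x : tower_span n x -> tower_span n.+1 x.
Proof. by move=> nx; rewrite -[x]mulr1; apply/tower_spanM/tower_span1. Qed.

Lemma tower_span_leq n m x : (n <= m)%N -> tower_span n x -> tower_span m x.
Proof.
move=> /subnK <- nx; elim: (m - n)%N => // d IHd.
by rewrite addSn; apply: tower_spanS.
Qed.

Lemma tower_span_gen a : exists n, tower_span n a.
Proof.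
pose S : {pred A} := fun a => `[< exists n, tower_span n a >].
suff : a \in S by move=> /asboolP.
apply: Mgen => [|p]; last by apply/asboolP; exists 0; apply: in_span_mem.
split=> [|c u v /asboolP[n nu] /asboolP[m mv]|
  u v /asboolP[n nu] /asboolP[m mv]]; apply/asboolP; first by exists 0.
- exists (maxn n m); apply: in_span_lin.
    exact: tower_span_leq (leq_maxl n m) nu.
  exact: tower_span_leq (leq_maxr n m) mv.
- exists (maxn n m).+1; apply: tower_spanM.
    exact: tower_span_leq (leq_maxl n m) nu.
  exact: tower_span_leq (leq_maxr n m) mv.
Qed.

Lemma tower_span_ext n (U : lmodType k) (f g : {linear A -> U}) :
  (forall x y, tower_span n x -> tower_span n y -> f (x * y) = g (x * y)) ->
  forall z, tower_span n.+1 z -> f z = g z.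
Proof.
move=> fg _ [c ->]; rewrite !linear_sum; apply: eq_bigr => -[i j] _.
rewrite !linearZ /=; congr (_ *: _); apply: fg.
  exact: (in_span_mem (coefs (@tower n)) (i.1, j.1)).
exact: (in_span_mem (coefs (@tower n)) (i.2, j.2)).
Qed.

Definition point_derivation_on n (l : {linear A -> k^o}) : Prop :=
  forall x y, tower_span n x -> tower_span n y ->
  l (x * y) = l x * eps y + eps x * l y.

Lemma point_derivation_onS n l :
  point_derivation_on n.+1 l -> point_derivation_on n l.
Proof. by move=> ld x y nx ny; apply: ld; apply: tower_spanS. Qed.

Lemma point_derivation_on_leq n m l : (n <= m)%N ->
  point_derivation_on m l -> point_derivation_on n l.
Proof.
move=> nm ld x y nx ny.
by apply: ld; apply: tower_span_leq nm _.
Qed.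

(** The product rule on V_n computes l on V_(n+1), so values on V_0 propagate up to level n + 1. *)
Lemma point_derivation_on_eq n l l' :
  point_derivation_on n l -> point_derivation_on n l' ->
  (forall p, l (coefs M p) = l' (coefs M p)) ->
  forall m, (m <= n.+1)%N -> forall x, tower_span m x -> l x = l' x.
Proof.
move=> ld ld' ll'; elim=> [_ _ [c ->]|m IHm mn].
  rewrite !linear_sum; apply: eq_bigr => p _.
  by rewrite !linearZ /= ll'.
apply: tower_span_ext => x y mx my.
have mn' : (m <= n)%N by [].
rewrite (point_derivation_on_leq mn' ld) // (point_derivation_on_leq mn' ld') //.
by rewrite !IHm // ltnW.
Qed.

(* A functional that is a point derivation on V_d agrees, by the choice of d, on
   V_0 with one on V_n for every n; these are unique, hence glue on O(G). *)
Lemma point_derivation_extend : exists d, forall l, point_derivation_on d l ->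
  exists l' : {linear A -> k^o}, point_derivation l' /\
    forall x, tower_span d.+1 x -> l' x = l x.
Proof.
(* A functional on V_0 is recorded by its values on the coefficients of M, in a finite-dimensional
   space to which [descending_chain] applies. *)
pose P n (X : {ffun I * I -> k^o}) := exists2 l : {linear A -> k^o},
  point_derivation_on n l & forall p, l (coefs M p) = X p.
have [|||d dP] := @descending_chain k {ffun I * I -> k^o} P.
- move=> n; have /linear_build[z zE] : linear ((fun=> 0) : A -> k^o).
    by move=> a x y; rewrite scaler0 addr0.
  by exists z => [x y _ _|p]; rewrite !zE ?ffunE // mul0r mulr0 addr0.
- move=> n a X Y [l ld lX] [l' ld' lY].
  have /linear_build[f fE] : linear (fun x => a *: l x + l' x : k^o).
    move=> b u v; rewrite !linearP /=; move: (l u) (l v) (l' u) (l' v) => p q r s.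
    change (b * (a * p) + a * q + (b * r + s) =
      a * (b * p) + b * r + (a * q + s) :> k).
    by ring.
  exists f => [x y nx ny|p]; last by rewrite fE !ffunE lX lY.
  rewrite !fE ld // ld' //.
  move: (l x) (l y) (l' x) (l' y) (eps x) (eps y) => p q r s u v.
  change (a * (p * v + u * q) + (r * v + u * s) =
    (a * p + r) * v + u * (a * q + s) :> k).
  by ring.
- by move=> n X [l /point_derivation_onS ld lX]; exists l.
exists d => l ld.
have /choice[f fP] : forall n, exists f : {linear A -> k^o},
    point_derivation_on n f /\ forall p, f (coefs M p) = l (coefs M p).
  move=> n; pose X : {ffun I * I -> k^o} := [ffun p => l (coefs M p)].
  have /(dP n)[f fd fX] : P d X by exists l => // p; rewrite ffunE.
  by exists f; split=> // p; rewrite fX ffunE.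
have fE n m x : tower_span n x -> tower_span m x -> f n x = f m x.
  have aux n' m' : (n' <= m')%N -> tower_span n' x -> f n' x = f m' x.
    move=> nm nx; have [[fd fX] [fd' fX']] := (fP n', fP m').
    apply: (point_derivation_on_eq fd) nx => // [|p].
      exact: point_derivation_on_leq nm fd'.
    by rewrite fX fX'.
  move=> nx mx; have [/aux/(_ nx) //|/ltnW/aux/(_ mx) -> //] := leqP n m.
(* [f n] is determined one level beyond V_n. This level is needed because the product rule of [f n]
   concerns elements x y of V_(n+1). *)
have fS n x : tower_span n.+1 x -> f n.+1 x = f n x.
  have [[fd fX] [fd' fX']] := (fP n.+1, fP n).
  apply: (point_derivation_on_eq (point_derivation_onS fd) fd') => // p.
  by rewrite fX fX'.
have /choice[N NP] := tower_span_gen.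
pose l' a := f (N a) a.
have l'E n a : tower_span n a -> l' a = f n a by apply: fE.
have common x y : exists n, tower_span n x /\ tower_span n y.
  exists (maxn (N x) (N y)); split.
    exact: tower_span_leq (leq_maxl _ _) (NP x).
  exact: tower_span_leq (leq_maxr _ _) (NP y).
have /linear_build[g gE] : linear (l' : A -> k^o).
  move=> a x y; have [n [nx ny]] := common x y.
  by rewrite (l'E n) ?(l'E n x) ?(l'E n y) ?linearP //; apply: in_span_lin.
exists g; split=> [x y|x dx].
  have [n [nx ny]] := common x y.
  rewrite !gE (l'E n x) // (l'E n y) // -(fP n).1 // -fS; last exact: tower_spanM.
  exact/l'E/tower_spanM.
rewrite gE (l'E d.+1) // fS //.
exact: (point_derivation_on_eq (fP d).1 ld (fP d).2) dx.
Qed.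
End Tower.

(** * Adjoining operators to an algebra *)

Section Realization.
Context (k : fieldType) (I : finType) (M : vectType k).
Context (phi : I -> {linear M -> M}) (mu : {bilinear M -> M -> M}).

(* Elements are (c, f, m), standing for c e + sum_i f_i e_i + m, where e is a
   unit for the idempotents e_i, e_i m = phi_i m, and e m = m e = m e_i = 0. *)
Definition extension : vectType k := (k^o * {ffun I -> k^o} * M)%type.

Definition ext_mul (u v : extension) : extension :=
  (u.1.1 * v.1.1,
   [ffun i => u.1.1 * v.1.2 i + u.1.2 i * v.1.1 + u.1.2 i * v.1.2 i],
   \sum_i (u.1.2 i : k) *: phi i v.2 + mu u.2 v.2).

Lemma ext_pairP (u v : extension) :
  u.1.1 = v.1.1 -> (forall i, u.1.2 i = v.1.2 i) -> u.2 = v.2 -> u = v.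
Proof.
by case: u v => [[a f] m] [[b g] n] /= -> fg ->; congr (_, _, _); apply/ffunP.
Qed.

Lemma ext_mul_linear_r u : linear (ext_mul u).
Proof.
move=> a v w; apply: ext_pairP => [|i|] /=.
- change (u.1.1 * (a * v.1.1 + w.1.1) =
    a * (u.1.1 * v.1.1) + u.1.1 * w.1.1 :> k); ring.
- rewrite !ffunE /= ?ffunE.
  change (u.1.1 * (a * v.1.2 i + w.1.2 i) + u.1.2 i * (a * v.1.1 + w.1.1) +
    u.1.2 i * (a * v.1.2 i + w.1.2 i) =
    a * (u.1.1 * v.1.2 i + u.1.2 i * v.1.1 + u.1.2 i * v.1.2 i) +
    (u.1.1 * w.1.2 i + u.1.2 i * w.1.1 + u.1.2 i * w.1.2 i) :> k); ring.
- rewrite linearPr scalerDr addrACA; congr (_ + _).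
  rewrite scaler_sumr -big_split; apply: eq_bigr => i _ /=.
  by rewrite linearP scalerDr !scalerA mulrC.
Qed.

Lemma ext_mul_linear_l v : linear (ext_mul^~ v).
Proof.
move=> a u w; apply: ext_pairP => [|i|] /=.
- change ((a * u.1.1 + w.1.1) * v.1.1 =
    a * (u.1.1 * v.1.1) + w.1.1 * v.1.1 :> k); ring.
- rewrite !ffunE /= ?ffunE.
  change ((a * u.1.1 + w.1.1) * v.1.2 i + (a * u.1.2 i + w.1.2 i) * v.1.1 +
    (a * u.1.2 i + w.1.2 i) * v.1.2 i =
    a * (u.1.1 * v.1.2 i + u.1.2 i * v.1.1 + u.1.2 i * v.1.2 i) +
    (w.1.1 * v.1.2 i + w.1.2 i * v.1.1 + w.1.2 i * v.1.2 i) :> k); ring.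
- rewrite linearPl scalerDr addrACA; congr (_ + _).
  rewrite scaler_sumr -big_split; apply: eq_bigr => i _ /=.
  by rewrite !ffunE scalerDl scalerA.
Qed.

Lemma ext_mul_bilinear : exists nu : {bilinear extension -> extension -> extension},
  (nu : extension -> extension -> extension) = ext_mul.
Proof.
have [nu nuE] := bilinear_build ext_mul_linear_l ext_mul_linear_r.
by exists nu; apply/funext => u; apply/funext => v; rewrite nuE.
Qed.

Definition ext_lift (E : M -> M) (u : extension) : extension := (0, 0, E u.2).

Lemma ext_lift_derivation (E : M -> M) :
  derivation mu E -> (forall i m, E (phi i m) = phi i (E m)) ->
  derivation ext_mul (ext_lift E).
Proof.
move=> [Elin Emu] Ephi; have [E' E'E] := linear_build Elin.
have {E'E} EE : E = E' by apply/funext => m; rewrite E'E.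
subst E.
split=> [a u v|u v]; apply: ext_pairP => [|i|] /=.
- by rewrite scaler0 addr0.
- by rewrite !ffunE scaler0 addr0.
- exact: Elin.
- by rewrite mul0r mulr0 addr0.
- by rewrite !ffunE /= ?ffunE !(mul0r, mulr0, addr0).
- rewrite linearD Emu linear_sum.
  rewrite [X in _ = X + _ + _]big1 => [|i _]; last by rewrite ffunE scale0r.
  rewrite add0r addrCA; congr (_ + _); congr (_ + _).
  by apply: eq_bigr => i _; rewrite linearZ /= Ephi.
Qed.

(** The multiplication table pins D down: the idempotents are killed, M is the part annihilated by
    e, and left multiplication by e_i on M is phi_i. *)
Lemma ext_derivation (D : extension -> extension) : derivation ext_mul D ->
  exists E, [/\ derivation mu E, forall i m, E (phi i m) = phi i (E m) &
    D = ext_lift E].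
Proof.
move=> [Dlin Dmul]; have /linear_build[D' D'E] := Dlin.
pose e : extension := (1, 0, 0).
pose ei i : extension := (0, [ffun j => (i == j)%:R], 0).
pose im m : extension := (0, 0, m).
have mule u : ext_mul e u = (u.1, 0).
  apply: ext_pairP => [|i|] /=; first by rewrite mul1r.
    by rewrite !ffunE /= mul1r !mul0r !addr0.
  by rewrite big1 ?add0r ?linear0l // => i _; rewrite ffunE scale0r.
have muleR u : ext_mul u e = (u.1, 0).
  apply: ext_pairP => [|i|] /=; first by rewrite mulr1.
    by rewrite !ffunE /= !mulr0 add0r mulr1 addr0.
  by rewrite linear0r addr0 big1 // => i _; rewrite linear0 scaler0.
(* Both multiplications by e project onto the span of e and the e_i. Applied to e e = e, the Leibniz
   rule makes the component of D e in that span equal to twice itself, hence zero in every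
   characteristic, and leaves no component in M. *)
have De : D e = 0.
  have := Dmul e e; rewrite mule muleR mule -[(e.1, 0)]/e => De.
  have [De1 De2] : (D e).1 = (D e).1 + (D e).1 /\ (D e).2 = 0.
    by rewrite [X in X.1 = _ /\ X.2 = _]De /= addr0.
  have De10 : (D e).1 = 0 by apply: (addrI (D e).1); rewrite addr0 -De1.
  by rewrite [LHS]surjective_pairing De2 De10.
have DF (u : extension) : u.2 = 0 -> (D u).2 = 0.
  move=> u0; have -> : u = ext_mul e u by rewrite mule -u0 -surjective_pairing.
  by rewrite Dmul De mule /= linear0l !addr0 big1 // => i _; rewrite ffunE scale0r.
have mul0 u : ext_mul 0 u = 0.
  have := ext_mul_linear_l u (-1) 0 0.
  by rewrite scaleN1r addNr scaleN1r addNr.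
have D0 : D 0 = 0 by rewrite -D'E linear0.
(* From e m = 0 and D e = 0 it follows that e D(m) = 0, so D(m) lies in M. *)
have DM m : (D (im m)).1 = 0.
  have := Dmul e (im m); rewrite De mule mul0 add0r mule.
  by rewrite -[(_, 0)]/(0 : extension) D0 => /(congr1 fst).
(* The same argument for the idempotent e_i: by [DF], D(e_i) has no component in M, its
   e_i-coordinate equals twice itself, and the other coordinates vanish at once. *)
have Dei i : D (ei i) = 0.
  have eiu u : u.2 = 0 -> ext_mul (ei i) u =
      (0, [ffun j => (i == j)%:R * (u.1.1 + u.1.2 j)], 0).
    move=> u0; apply: ext_pairP => [|j|] /=; first by rewrite mul0r.
      by rewrite !ffunE mul0r add0r mulrDr.
    rewrite u0 linear0r addr0 big1 // => j _.
    by rewrite linear0 scaler0.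
  have uei u : u.2 = 0 -> ext_mul u (ei i) =
      (0, [ffun j => (i == j)%:R * (u.1.1 + u.1.2 j)], 0).
    move=> u0; apply: ext_pairP => [|j|] /=; first by rewrite mulr0.
      by rewrite !ffunE mulr0 addr0 -mulrDl mulrC.
    rewrite u0 linear0r addr0 big1 // => j _.
    by rewrite linear0 scaler0.
  have Dei2 : (D (ei i)).2 = 0 by apply: DF.
  have ei_idem : ext_mul (ei i) (ei i) = ei i.
    rewrite eiu //; apply: ext_pairP => //= j; rewrite !ffunE add0r.
    by case: eqP; rewrite ?mul1r ?mul0r.
  have := Dmul (ei i) (ei i); rewrite ei_idem eiu // uei // => Dei.
  have Dei1 : (D (ei i)).1.1 = 0 by rewrite Dei /= addr0.
  apply: ext_pairP => //= j; rewrite [RHS]ffunE.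
  have := congr1 (fun u : extension => u.1.2 j) Dei.
  rewrite /= !ffunE Dei1 add0r; case: eqP => _; rewrite ?mul0r ?addr0 // !mul1r.
  by move=> Deij; apply: (addrI ((D (ei i)).1.2 j)); rewrite addr0 -Deij.
pose E m := (D (im m)).2.
have DE u : D u = ext_lift E u.
  have {1}-> : u = u.1.1 *: e + \sum_i u.1.2 i *: ei i + im u.2.
    have sumE (J : finType) (F : J -> extension) :
        \sum_i F i = (\sum_i (F i).1.1, \sum_i (F i).1.2, \sum_i (F i).2).
      rewrite [LHS]surjective_pairing [X in (X, _)]surjective_pairing.
      congr (_, _, _).
      - exact: (big_morph (fun u : extension => u.1.1)).
      - exact: (big_morph (fun u : extension => u.1.2)).
      - exact: (big_morph (fun u : extension => u.2)).
    rewrite sumE; apply: ext_pairP => [|i|] /=.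
    - by rewrite big1 ?addr0 => [|i _]; rewrite ?[_ *: _]mulr1 ?[_ *: _]mulr0.
    - rewrite !ffunE sum_ffunE addr0 (bigD1 i) //= !ffunE eqxx big1 => [|j ji].
        by rewrite addr0 [X in X + _]mulr0 add0r [RHS]mulr1.
      by rewrite !ffunE (negPf ji) [LHS]mulr0.
    - by rewrite big1 ?scaler0 ?add0r // => i _; rewrite scaler0.
  rewrite -!D'E !linearD linearZ linear_sum /= !D'E De scaler0 add0r big1.
    by rewrite add0r [LHS]surjective_pairing DM.
  by move=> i _; rewrite linearZ /= D'E Dei scaler0.
exists E; split; last exact/funext.
  split=> [a m n|m n].
    have -> : E (a *: m + n) = (D (a *: im m + im n)).2.
      by rewrite /E; congr (D _).2; apply: ext_pairP => [|i|] //=;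
        rewrite ?ffunE scaler0 addr0.
    by rewrite Dlin.
  have mulM p q : ext_mul (im p) (im q) = im (mu p q).
    apply: ext_pairP => [|i|] /=; first by rewrite mul0r.
      by rewrite !ffunE /= !mul0r !addr0.
    by rewrite big1 ?add0r // => i _; rewrite ffunE scale0r.
  have DimE p : D (im p) = im (E p) by rewrite DE.
  have := Dmul (im m) (im n); rewrite mulM !DimE !mulM => /(congr1 snd).
  by [].
move=> i m.
have mulei p : ext_mul (ei i) (im p) = im (phi i p).
  apply: ext_pairP => [|j|] /=; first by rewrite mul0r.
    by rewrite !ffunE /= ?ffunE !(mulr0, mul0r, addr0).
  rewrite linear0l addr0 (bigD1 i) //= ffunE eqxx scale1r big1 ?addr0 // => j ji.
  by rewrite ffunE eq_sym (negPf ji) scale0r.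
have := Dmul (ei i) (im m); rewrite mulei Dei mul0 add0r !DE.
have -> : ext_lift E (im m) = im (E m) by [].
by rewrite mulei => /(congr1 snd).
Qed.
End Realization.

(** * Lie(G) as a derivation algebra *)

(** Conditions on bare endomorphisms, so that the membership proofs packed in [lie_of] are dealt
    with once for both directions of the theorem. *)
Lemma lie_of_iso (k : fieldType) (V W : lmodType k) (S : lieSubalgebra V)
    (T : lieSubalgebra W) (F : (V -> V) -> W -> W) :
  (forall D, lsub_mem S D -> lsub_mem T (F D)) ->
  (forall a D E, lsub_mem S D -> lsub_mem S E ->
     forall w, F (fun x => a *: D x + E x) w = a *: F D w + F E w) ->
  (forall D E, lsub_mem S D -> lsub_mem S E ->
     forall w, F (commutator D E) w = commutator (F D) (F E) w) ->
  (forall D E, lsub_mem S D -> lsub_mem S E -> F D = F E ->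
     forall v, D v = E v) ->
  (forall E, lsub_mem T E -> exists2 D, lsub_mem S D & F D = E) ->
  lie_isomorphic (lie_of S) (lie_of T).
Proof.
move=> FT Flin Fcom Finj Fsurj.
have mem (U : lmodType k) (P : lieSubalgebra U) (D : lie_of P) : lsub_mem P D.
  exact/asboolP/(endo_ofP D).
have FP (D : lie_of S) : F D \in lsub_pred T by apply/asboolP/FT/mem.
pose f D : lie_of T := LieOf (FP D).
apply: (@lie_isomorphic_build _ _ _ f) => [a D E|D E|E|D E].
- by apply: lie_of_ext => w; apply: (Flin a D E); apply: mem.
- by move=> /(congr1 (@endo_of _ _ _)) /Finj DE; apply: lie_of_ext; apply: DE; exact: mem.
- have [D SD DE] := Fsurj E (mem _ _ E).
  have SD' : D \in lsub_pred S by apply/asboolP.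
  by exists (LieOf SD'); apply: lie_of_ext => w; rewrite /= DE.
- by apply: lie_of_ext => w; apply: Fcom; apply: mem.
Qed.

(** Dual functionals extend the coordinate map of the span to all of V. It then composes freely with
    linear maps of V, and membership in the span is needed only to cancel it. *)
Lemma span_coordinates (k : fieldType) (V : lmodType k) (I : finType)
    (v : I -> V) :
  exists r (incl : {linear 'rV[k]_r -> V}) (crd : {linear V -> 'rV[k]_r}),
  [/\ forall x, crd (incl x) = x, forall x, in_span v (incl x) &
    forall a, in_span v a -> incl (crd a) = a].
Proof.
have [r [w [wfree wv]]] := free_span v.
have [d dE] := dual_functionals wfree.
have [incl inclE] : exists incl : {linear 'rV[k]_r -> V},
    forall x, incl x = \sum_i x 0 i *: w i.
  apply: linear_build => a x y; rewrite scaler_sumr -big_split.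
  by apply: eq_bigr => i _; rewrite !mxE scalerDl scalerA.
have [crd crdE] : exists crd : {linear V -> 'rV[k]_r},
    forall a, crd a = \row_i (d i a : k).
  by apply: linear_build => a x y; apply/rowP => i; rewrite !mxE linearP.
have crdK x : crd (incl x) = x.
  apply/rowP => i; rewrite crdE mxE inclE linear_sum (bigD1 i) //= linearZ /=.
  rewrite dE eqxx big1 => [|j ji]; first by rewrite addr0 [LHS]mulr1.
  by rewrite linearZ /= dE eq_sym (negPf ji) scaler0.
have inclP x : in_span v (incl x) by apply/wv; rewrite inclE; exists (x 0).
exists r, incl, crd; split=> // a /wv[c ->].
suff -> : \sum_i c i *: w i = incl (\row_i c i) by rewrite crdK.
by rewrite inclE; apply: eq_bigr => i _; rewrite mxE.
Qed.

Section LieIsDer.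
Context (k : fieldType) (G : algGroup k).
Local Notation A := (Defs.coord G).
Local Notation eps := (counit G).

Lemma left_invariant_span (D : {linear A -> A}) (I : finType) (M : I -> I -> A) a :
  left_invariant_derivation D -> corep M -> in_span (coefs M) a ->
  in_span (coefs M) (D a).
Proof.
move=> Dinv cM [c ->]; rewrite linear_sum.
under eq_bigr do rewrite linearZ /=.
apply: in_span_sum => -[i j]; rewrite (left_invariant_slice Dinv (cM i j)).
by apply: in_span_sum => l; apply: (in_span_mem (coefs M) (i, l)).
Qed.

Lemma left_slice_span (l : {linear A -> k^o}) (L : {linear A -> A})
    (I : finType) (M : I -> I -> A) a :
  (forall (J : finType) (b c : J -> A) a, comul b c a ->
     L a = \sum_i (l (b i) : k) *: c i) ->
  corep M -> in_span (coefs M) a -> in_span (coefs M) (L a).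
Proof.
move=> LE cM [c ->]; rewrite linear_sum.
under eq_bigr do rewrite linearZ /=.
apply: in_span_sum => -[i j]; rewrite (LE _ _ _ _ (cM i j)).
by apply: in_span_sum => m; apply: (in_span_mem (coefs M) (m, j)).
Qed.

(** L contracts the left factor of Delta and D the right one, so they commute by coassociativity,
    which is visible on matrix coefficients. *)
Lemma left_slice_comm (l : {linear A -> k^o}) (L D : {linear A -> A}) a :
  (forall (J : finType) (b c : J -> A) a, comul b c a ->
     L a = \sum_i (l (b i) : k) *: c i) ->
  left_invariant_derivation D -> D (L a) = L (D a).
Proof.
move=> LE Dinv; have [n [M [cM [c ->]]]] := in_corep a.
rewrite !linear_sum; apply: eq_bigr => -[i j] _; rewrite !linearZ /coefs /=.
congr (_ *: _).
rewrite (LE _ _ _ _ (cM i j)) (left_invariant_slice Dinv (cM i j)) !linear_sum.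
under eq_bigr do rewrite linearZ /= (left_invariant_slice Dinv (cM _ j)) scaler_sumr.
rewrite exchange_big; apply: eq_bigr => m _.
rewrite linearZ /= (LE _ _ _ _ (cM i m)) scaler_sumr; apply: eq_bigr => p _.
by rewrite !scalerA mulrC.
Qed.

Lemma Lie_Der : exists (B : vectType k) (mu : {bilinear B -> B -> B}),
  lie_isomorphic (Lie G) (Der mu).
Proof.
have [s sgen] := coord_fin_generated G.
(* The element 1 joins the generators so that V_0 contains it and the V_n increase. *)
have [I [M [cM sM]]] := in_corep_seq (1 :: s).
have M1 : in_span (coefs M) 1 by apply: sM; rewrite mem_head.
have Mgen (S : {pred A}) : GRing.subalg_closed S ->
    (forall p, coefs M p \in S) -> forall a, a \in S.
  move=> Salg MS; apply: sgen (Salg) _ => a sa.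
  have [c ->] := sM a (mem_behead (s := 1 :: s) sa).
  have [_ Slin _] := Salg.
  have S0 : 0 \in S.
    by have [S1 _ _] := Salg; rewrite -(addNr 1) -scaleN1r; apply: Slin.
  elim/big_rec: _ => // p x _ xS; exact: Slin.
have [d dext] := point_derivation_extend M1 Mgen.
pose P := tower_span M d; pose P' := tower_span M d.+1.
have PP' x : P x -> P' x by apply: tower_spanS.
have PM x y : P x -> P y -> P' (x * y) by apply: tower_spanM.
have P'D x y : P' x -> P' y -> P' (x + y).
  by move=> Px Py; rewrite -[x]scale1r; apply: in_span_lin.
have cT n : corep (@tower _ _ _ M n) by apply: tower_corep.
have [r [i [c [iK iP cK]]]] := span_coordinates (coefs (@tower _ _ _ M d)).
have [r' [i' [c' [i'K i'P c'K]]]] := span_coordinates (coefs (@tower _ _ _ M d.+1)).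
rewrite -/P in iP cK; rewrite -/P' in i'P c'K.
(* The coordinate functionals of V_d. The left translations [L] that they define are the finitely
   many needed, because eps o L_t is the t-th coordinate. *)
have /choice[l lE] : forall s, exists l : {linear A -> k^o}, forall a, l a = c a 0 s.
  by move=> t; apply: linear_build => a x y; rewrite linearP !mxE.
have /choice[L LE] := fun s => left_slice (l s).
pose N : vectType k := ('rV[k]_r * 'rV[k]_r')%type.
have [mu muE] : exists mu : {bilinear N -> N -> N},
    forall u v, mu u v = (0, c' (i u.1 * i v.1)).
  apply: bilinear_build => [v a u w|u a v w]; congr (_, _) => /=;
    by rewrite ?scaler0 ?addr0 // linearP ?mulrDl ?mulrDr -?scalerAl -?scalerAr linearP.
(* Commutation with [pr] makes an endomorphism block diagonal; [jn] is the inclusion V_d -> V_(d+1),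
   and [tr] gives the left translations of V_d. *)
have [pr prE] : exists pr : {linear N -> N}, forall u, pr u = (u.1, 0).
  by apply: linear_build => a u v; congr (_, _); rewrite /= ?scaler0 ?addr0.
have [jn jnE] : exists jn : {linear N -> N}, forall u, jn u = (0, c' (i u.1)).
  apply: linear_build => a u v; congr (_, _); rewrite /= ?scaler0 ?addr0 //.
  by rewrite !linearP.
have /choice[tr trE] : forall t, exists tr : {linear N -> N},
    forall u, tr u = (c (L t (i u.1)), 0).
  move=> t; apply: linear_build => a u v; congr (_, _); rewrite /= ?scaler0 ?addr0 //.
  by rewrite !linearP.
pose phi (t : ('I_r + bool)%type) : {linear N -> N} :=
  match t with inl t => tr t | inr true => pr | inr false => jn end.
have [Mu MuE] := ext_mul_bilinear phi mu.
exists (extension ('I_r + bool)%type N), Mu.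
pose act (D : A -> A) (u : N) : N := (c (D (i u.1)), c' (D (i' u.2))).
pose F D := ext_lift (act D) : extension ('I_r + bool)%type N -> _.
have linD (D : A -> A) : left_invariant_derivation D -> exists D' : {linear A -> A}, D = D'.
  by move=> [[/linear_build[D' D'E] _] _]; exists D'; apply/funext => x; rewrite D'E.
have Dmul (D : A -> A) : left_invariant_derivation D -> forall x y,
  D (x * y) = D x * y + x * D y by move=> [[]].
have DP D n x : left_invariant_derivation D -> tower_span M n x ->
    tower_span M n (D x).
  by move=> Dinv; have [D' DD] := linD _ Dinv; subst D; apply: left_invariant_span.
apply: (@lie_of_iso _ _ _ _ _ F).
- move=> D; change (left_invariant_derivation D -> derivation Mu (F D)) => Dinv.
  rewrite MuE.
  have [D' DD] := linD _ Dinv; subst D.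
  apply: ext_lift_derivation.
    split=> [a u v|u v]; first by rewrite /act /= !linearP.
    rewrite !muE /act /= linear0 linear0; congr (_, _) => /=.
      by rewrite linear0 addr0.
    rewrite c'K; last by apply: PM; apply: iP.
    rewrite (Dmul _ Dinv) linearD !cK //;
      by apply: (DP _ _ _ Dinv); apply: iP.
  move=> [t|[]] u /=.
  - rewrite !trE /act /= !linear0; congr (_, _).
    rewrite (cK (L t _)); last exact: left_slice_span (LE t) (cT _) (iP _).
    rewrite (cK (D' _)); last exact: (DP _ _ _ Dinv (iP _)).
    by rewrite (left_slice_comm _ (LE t)).
  - by rewrite !prE /act /= !linear0.
  - rewrite !jnE /act /= !linear0; congr (_, _).
    rewrite (cK (D' _)); last exact: (DP _ _ _ Dinv (iP _)).
    by rewrite c'K //; apply/PP'/iP.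
- move=> a D E Dinv' Einv' w.
  have Dinv : left_invariant_derivation D := Dinv'.
  have Einv : left_invariant_derivation E := Einv'.
  have [D1 DD] := linD _ Dinv; have [E1 EE] := linD _ Einv; subst D E.
  apply: ext_pairP => [|t|] /=; first by rewrite scaler0 addr0.
    by rewrite !ffunE scaler0 addr0.
  by rewrite /act /= !linearP.
- move=> D E Dinv' Einv' w.
  have Dinv : left_invariant_derivation D := Dinv'.
  have Einv : left_invariant_derivation E := Einv'.
  have [D1 DD] := linD _ Dinv; have [E1 EE] := linD _ Einv; subst D E.
  apply: ext_pairP => [|t|] /=; first by rewrite subr0.
    by rewrite !ffunE subr0.
  rewrite /act /= (cK (E1 _)); last exact: (DP _ _ _ Einv (iP _)).
  rewrite (cK (D1 _)); last exact: (DP _ _ _ Dinv (iP _)).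
  rewrite (c'K (E1 _)); last exact: (DP _ _ _ Einv (i'P _)).
  rewrite (c'K (D1 _)); last exact: (DP _ _ _ Dinv (i'P _)).
  by rewrite /commutator !linearB.
- move=> D E Dinv' Einv' FDE.
  have Dinv : left_invariant_derivation D := Dinv'.
  have Einv : left_invariant_derivation E := Einv'.
  have DE x : P x -> D x = E x.
    move=> Px; have := congr1 (fun f => (f (0, 0, (c x, 0))).2.1) FDE.
    rewrite /F /ext_lift /act /= cK // => /(congr1 i).
    by rewrite !cK //; apply: DP.
  (* D and E agree on V_d, which contains the coefficients of M; these generate O(G), and the
     elements where two derivations agree form a subalgebra. *)
  pose S : {pred A} := fun a => `[< D a = E a >].
  move=> a; suff : a \in S by move=> /asboolP.
  have [[Dlin _] _] := Dinv; have [[Elin _] _] := Einv.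
  apply: Mgen => [|p]; last first.
    apply/asboolP/DE/(tower_span_leq M1 (leq0n d)).
    exact: (in_span_mem (coefs M)).
  split=> [|t u v /asboolP Su /asboolP Sv|u v /asboolP Su /asboolP Sv]; apply/asboolP.
  + by apply/DE/tower_span1.
  + by rewrite Dlin Elin Su Sv.
  + by rewrite (Dmul _ Dinv) (Dmul _ Einv) Su Sv.
- move=> X; change (derivation Mu X -> exists2 D, left_invariant_derivation D & F D = X).
  rewrite MuE => /ext_derivation[E [[Elin Emu] Ephi ->]].
  have [EL EE] := linear_build Elin.
  have {EE} EE : E = EL by apply/funext => u; rewrite EE.
  subst E.
  have Epr u : EL (u.1, 0) = ((EL u).1, 0) by rewrite -!prE (Ephi (inr true)).
  have [E1 E1E] : exists E1 : {linear 'rV[k]_r -> 'rV[k]_r},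
      forall x, E1 x = (EL (x, 0)).1.
    apply: linear_build => a x y.
    have -> : (a *: x + y, 0) = a *: ((x, 0) : N) + (y, 0).
      by congr (_, _); rewrite /= ?scaler0 ?addr0.
    by rewrite linearP.
  have [E2 E2E] : exists E2 : {linear 'rV[k]_r' -> 'rV[k]_r'},
      forall y, E2 y = (EL (0, y)).2.
    apply: linear_build => a x y.
    have -> : (0, a *: x + y) = a *: ((0, x) : N) + (0, y).
      by congr (_, _); rewrite /= ?scaler0 ?addr0.
    by rewrite linearP.
  have ELE u : EL u = (E1 u.1, E2 u.2).
    have -> : EL u = EL (u.1, 0) + EL (0, u.2).
      rewrite -linearD; congr (EL _); rewrite [LHS]surjective_pairing.
      by congr (_, _); rewrite /= ?addr0 ?add0r.
    have E0 : (EL (0, u.2)).1 = 0.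
      have := Epr (0, u.2); have -> : EL (((0, u.2) : N).1, 0) = 0 by exact: linear0.
      by move=> /(congr1 fst) /= <-.
    have E0' : (EL (u.1, 0)).2 = 0 by have := Epr u => ->.
    rewrite E1E E2E [LHS]surjective_pairing; congr (_, _); rewrite /= ?E0 ?addr0 //.
    by rewrite E0' add0r.
  have E12 x : E2 (c' (i x)) = c' (i (E1 x)).
    have := Ephi (inr false) (x, 0); rewrite /= !jnE !ELE.
    by move=> /(congr1 snd).
  have E1L t x : E1 (c (L t (i x))) = c (L t (i (E1 x))).
    have := Ephi (inl t) (x, 0); rewrite /= !trE !ELE.
    by move=> /(congr1 fst).
  have E2M x y : E2 (c' (i x * i y)) = c' (i (E1 x) * i y + i x * i (E1 y)).
    have := Emu (x, 0) (y, 0); rewrite !muE !ELE /= => /(congr1 snd) /= ->.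
    by rewrite linearD.
  (* By [E2M], the functional eps o E2 is a point derivation on V_d. Its extension to O(G) defines
     the left invariant derivation D sought. *)
  have [e eE] : exists e : {linear A -> k^o}, forall a, e a = eps (i' (E2 (c' a))).
    by apply: linear_build => a x y; rewrite !linearP.
  have eP x : P x -> e x = eps (i (E1 (c x))).
    by move=> Px; rewrite eE -{1}(cK x Px) E12 c'K //; apply/PP'/iP.
  have [|l' [l'd l'e]] := dext e.
    move=> x y Px Py; rewrite eE -{1}(cK x Px) -{1}(cK y Py) E2M !cK //.
    rewrite c'K; last by apply: P'D; apply: PM => //; apply: iP.
    by rewrite rmorphD !rmorphM /= -(eP x Px) -(eP y Py).
  have [D [Dinv DE _]] := left_invariant_of_point l'd.
  have epsL t a : eps (L t a) = l t a.
    have [n [b [b' abb]]] := comul_exists a.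
    rewrite (LE _ _ _ _ _ abb) [in RHS](comul_counitr abb) !linear_sum.
    by apply: eq_bigr => m _; rewrite !linearZ /= [LHS]mulrC.
  have LP t x : P x -> P (L t x) by apply: left_slice_span (LE t) (cT _).
  (* L_t commutes with D and with E1, and eps o L_t is the t-th coordinate. So it suffices that eps
     o D and eps o E1 agree on V_d, which holds by construction. *)
  have DPx x : P x -> i (E1 (c x)) = D x.
    move=> Px; have Dx : P (D x) by apply: DP.
    rewrite -(cK _ Dx); congr (i _); apply/rowP => t; rewrite -lE -epsL.
    rewrite -(left_slice_comm _ (LE t)) // DE l'e; last exact/PP'/LP.
    rewrite eP; last exact: LP.
    rewrite -{2}(cK x Px) E1L cK; last exact/LP/iP.
    by rewrite epsL lE iK.
  have DP'x x : P' x -> i' (E2 (c' x)) = D x.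
    have [f fE] : exists f : {linear A -> A}, forall x, f x = i' (E2 (c' x)).
      by apply: linear_build => a u v; rewrite !linearP.
    rewrite -fE; apply: tower_span_ext => {}x y Px Py.
    rewrite fE -{1}(cK x Px) -{1}(cK y Py) E2M !cK // !DPx // -(Dmul _ Dinv) c'K //.
    by apply: DP => //; apply: PM.
  exists D => //; congr ext_lift; apply/funext => u; rewrite ELE.
  by rewrite /act -(DPx _ (iP _)) -(DP'x _ (i'P _)) !iK !i'K.
Qed.
End LieIsDer.

(** * Quotient and polynomial algebras *)

Record ideal (R : comNzRingType) := Ideal {
  ideal_mem : R -> Prop;
  ideal0 : ideal_mem 0;
  ideal1 : ~ ideal_mem 1;
  idealP : forall a u v, ideal_mem u -> ideal_mem v -> ideal_mem (a * u + v) }.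

Definition ideal_pred (R : comNzRingType) (J : ideal R) : {pred R} :=
  fun a => `[< ideal_mem J a >].

Lemma ideal_pred_closed (R : comNzRingType) (J : ideal R) :
  idealr_closed (ideal_pred J).
Proof.
split=> [||a u v /asboolP Ju /asboolP Jv].
- exact/asboolP/ideal0.
- by apply/asboolP; apply: ideal1.
- exact/asboolP/idealP.
Qed.

HB.instance Definition _ (R : comNzRingType) (J : ideal R) :=
  isIdealr.Build R (ideal_pred J) (ideal_pred_closed J).

Section QuotientAlgebra.
Context (k : fieldType) (P : comAlgType k) (J : ideal P).

Definition quotient_alg : Type := {ideal_quot (ideal_pred J)}.
HB.instance Definition _ := GRing.ComNzRing.on quotient_alg.

Definition quotient_proj : {rmorphism P -> quotient_alg} :=
  \pi_({ideal_quot (ideal_pred J)})%qT.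

Definition quotient_scale (a : k) (x : quotient_alg) : quotient_alg :=
  quotient_proj (a%:A) * x.

Lemma quotient_scaleA a b x :
  quotient_scale a (quotient_scale b x) = quotient_scale (a * b) x.
Proof.
by rewrite /quotient_scale mulrA -rmorphM -scalerAl mul1r scalerA.
Qed.
Lemma quotient_scale1 : left_id 1 quotient_scale.
Proof. by move=> x; rewrite /quotient_scale scale1r rmorph1 mul1r. Qed.
Lemma quotient_scaleDr : right_distributive quotient_scale +%R.
Proof. by move=> a x y; rewrite /quotient_scale mulrDr. Qed.
Lemma quotient_scaleDl x : {morph quotient_scale^~ x : a b / a + b}.
Proof. by move=> a b; rewrite /quotient_scale scalerDl rmorphD mulrDl. Qed.

HB.instance Definition _ := GRing.Zmodule_isLmodule.Build k quotient_alg
  quotient_scaleA quotient_scale1 quotient_scaleDr quotient_scaleDl.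

Lemma quotient_scaleAl (a : k) (x y : quotient_alg) : a *: (x * y) = a *: x * y.
Proof. by rewrite -[LHS]/(_ * _) mulrA. Qed.

HB.instance Definition _ :=
  GRing.Lmodule_isLalgebra.Build k quotient_alg quotient_scaleAl.
HB.instance Definition _ := GRing.Lalgebra_isComAlgebra.Build k quotient_alg.

Lemma quotient_algP : exists (Q : comAlgType k) (p : alg_hom P Q),
  [/\ forall x, exists a, p a = x, forall a, p a = 0 <-> ideal_mem J a &
    forall (R : comAlgType k) (f : alg_hom P R),
      (forall a, ideal_mem J a -> f a = 0) ->
      exists g : alg_hom Q R, alg_comp g p = f].
Proof.
exists quotient_alg.
have [p pE] : exists p : alg_hom P quotient_alg, forall a, p a = quotient_proj a.
  apply: alg_hom_build => [a x y|]; last by split=> [|x y]; rewrite ?rmorph1 ?rmorphM.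
  by rewrite rmorphD -[RHS]/(_ * _ + _) -rmorphM -scalerAl mul1r.
have psurj x : exists a, p a = x by exists (repr x); rewrite pE; exact: reprK.
have pker a : p a = 0 <-> ideal_mem J a.
  have -> : (p a = 0) = (p a = p 0) by rewrite linear0.
  rewrite !pE; split=> [/eqP|Ja].
    by rewrite -Quotient.idealrBE subr0 => /asboolP.
  by apply/eqP; rewrite -Quotient.idealrBE subr0; apply/asboolP.
exists p; split=> // R f fJ.
have /choice[s sE] := psurj.
have fE a b : p a = p b -> f a = f b.
  move=> ab; apply/eqP; rewrite -subr_eq0 -rmorphB; apply/eqP/fJ/pker.
  by rewrite rmorphB /= ab subrr.
have [g gE] : exists g : alg_hom quotient_alg R, forall x, g x = f (s x).
  apply: alg_hom_build => [a x y|].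
    by rewrite -linearP; apply: fE; rewrite linearP /= !sE.
  split=> [|x y]; first by rewrite -(rmorph1 f); apply: fE; rewrite sE rmorph1.
  by rewrite -rmorphM; apply: fE; rewrite rmorphM /= !sE.
by exists g; apply: alg_hom_ext => a /=; rewrite gE; apply: fE; rewrite sE.
Qed.
End QuotientAlgebra.

Lemma free_algebra (k : fieldType) (I : finType) :
  exists (P : comAlgType k) (X : I -> P),
  (forall (R : comAlgType k) (z : I -> R),
     exists f : alg_hom P R, forall i, f (X i) = z i) /\
  (forall S : {pred P}, GRing.subalg_closed S -> (forall i, X i \in S) ->
     forall a, a \in S).
Proof.
pose P : comAlgType k := mpoly #|I| k; pose x i : P := mpolyX k (mnm1 i).
exists P, (x \o enum_rank); split=> [R z|S Salg SX p].
  pose h (i : 'I_#|I|) := z (enum_val i); pose f := mmap (in_alg R) h.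
  have [g gE] : exists g : alg_hom P R, forall p, g p = f p.
    apply: alg_hom_build => [a u v|].
      by rewrite /f mmapD mmapZ [in_alg R a * _]mulr_algl.
    by have [fM f1] := mmap_is_multiplicative h (in_alg R); split.
  by exists g => i; rewrite gE /f mmapX mmap1U /h enum_rankK.
have [S1 Slin SM] := Salg.
have S0 : 0 \in S by rewrite -(addNr 1) -scaleN1r; apply: Slin.
have SM1 u v : u \in S -> v \in S -> u * v \in S by apply: SM.
elim/mpolyind: p => [|c m p _ _ Sp]; first exact: S0.
apply: Slin => //; rewrite mpolyXE_id.
elim/big_ind: _ => // i _; elim: (m i) => [|e IHe]; first by rewrite expr0.
by rewrite exprS; apply: SM1 => //; rewrite -[i]enum_valK; apply: SX.
Qed.

(** * The automorphism group scheme of an algebra *)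

Section AutomorphismGroup.
Context (k : fieldType) (n : nat) (c : 'I_n -> 'I_n -> 'I_n -> k).
Implicit Types R S : comAlgType k.

Definition structure_mul R (u w : 'cV[R]_n) : 'cV[R]_n :=
  \col_m \sum_p \sum_q c p q m *: (u p 0 * w q 0).

Definition automorphism_mx R (X : 'M[R]_n) : Prop :=
  forall u w, X *m structure_mul u w = structure_mul (X *m u) (X *m w).

(** Evaluation at basis vectors turns the condition into polynomial equations in the entries, a form
    that passes along algebra maps. *)
Lemma automorphism_mxP R (X : 'M[R]_n) : automorphism_mx X <->
  forall p q m, \sum_l c p q l *: X m l =
    \sum_p' \sum_q' c p' q' m *: (X p' p * X q' q).
Proof.
split=> [XP p q m|XP u w].
  have := congr1 (fun v : 'cV[R]_n => v m 0) (XP (delta_mx p 0) (delta_mx q 0)).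
  rewrite !mxE => E; transitivity (\sum_j X m j *
      structure_mul (delta_mx p 0) (delta_mx q 0) j 0).
    apply: eq_bigr => l _; rewrite mxE (bigD1 p) //= (bigD1 q) //= !mxE !eqxx.
    rewrite mulr1 big1 => [|q' qq]; last by rewrite !mxE (negPf qq) mulr0 scaler0.
    rewrite big1 => [|p' pp]; last first.
      by apply: big1 => q' _; rewrite !mxE (negPf pp) mul0r scaler0.
    by rewrite !addr0 -scalerAr mulr1.
  rewrite {}E; apply: eq_bigr => p' _; apply: eq_bigr => q' _.
  have col (r r' : 'I_n) : (X *m delta_mx r (0 : 'I_1)) r' 0 = X r' r.
    by rewrite -colE mxE.
  by rewrite !col.
apply/colP => m; rewrite !mxE.
transitivity (\sum_p \sum_q \sum_l c p q l *: X m l * (u p 0 * w q 0)).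
  under eq_bigr do rewrite mxE mulr_sumr.
  rewrite exchange_big; apply: eq_bigr => p _ /=.
  under eq_bigr do rewrite mulr_sumr.
  rewrite exchange_big; apply: eq_bigr => q _ /=.
  by apply: eq_bigr => l _; rewrite -scalerAr -scalerAl.
under eq_bigr do under eq_bigr do rewrite -mulr_suml XP mulr_suml.
under eq_bigr do rewrite exchange_big /=.
rewrite exchange_big; apply: eq_bigr => p' _ /=.
under eq_bigr do under eq_bigr do rewrite mulr_suml.
under eq_bigr do rewrite exchange_big /=.
rewrite exchange_big; apply: eq_bigr => q' _ /=.
rewrite !mxE mulr_suml scaler_sumr; apply: eq_bigr => p _.
rewrite mulr_sumr scaler_sumr; apply: eq_bigr => q _.
by rewrite -scalerAl mulrACA.
Qed.

(** The inverse is carried as a second matrix, so that invertibility too is a system of polynomial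
    equations, without determinants. *)
Definition automorphism_pair R (X Y : 'M[R]_n) : Prop :=
  [/\ X *m Y = 1%:M, Y *m X = 1%:M & automorphism_mx X].

Lemma automorphism_pair1 R : automorphism_pair (1%:M : 'M[R]_n) 1%:M.
Proof. by split; rewrite ?mulmx1 // => u w; rewrite !mul1mx. Qed.

Lemma automorphism_pairM R (X Y X' Y' : 'M[R]_n) :
  automorphism_pair X Y -> automorphism_pair X' Y' ->
  automorphism_pair (X *m X') (Y' *m Y).
Proof.
move=> [XY YX XP] [XY' YX' XP']; split=> [||u w].
- by rewrite mulmxA -[X *m X' *m Y']mulmxA XY' mulmx1.
- by rewrite mulmxA -[Y' *m Y *m X]mulmxA YX mulmx1.
- by rewrite -!mulmxA XP' XP.
Qed.

Lemma automorphism_pairV R (X Y : 'M[R]_n) :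
  automorphism_pair X Y -> automorphism_pair Y X.
Proof.
move=> [XY YX XP]; split=> // u w.
rewrite -[u in LHS]mul1mx -[w in LHS]mul1mx -XY -!mulmxA -XP mulmxA YX.
exact: mul1mx.
Qed.

Lemma automorphism_pair_map R S (f : alg_hom R S) (X Y : 'M[R]_n) :
  automorphism_pair X Y -> automorphism_pair (map_mx f X) (map_mx f Y).
Proof.
move=> [XY YX /automorphism_mxP XP]; split.
- by rewrite -map_mxM XY map_mx1.
- by rewrite -map_mxM YX map_mx1.
- apply/automorphism_mxP => p q m.
  transitivity (f (\sum_l c p q l *: X m l)).
    by rewrite linear_sum; apply: eq_bigr => l _; rewrite linearZ mxE.
  rewrite XP linear_sum; apply: eq_bigr => p' _.
  rewrite linear_sum; apply: eq_bigr => q' _.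
  by rewrite linearZ /= rmorphM !mxE.
Qed.

Lemma automorphism_pair_inv R (X Y Y' : 'M[R]_n) :
  automorphism_pair X Y -> automorphism_pair X Y' -> Y = Y'.
Proof.
by move=> [XY YX _] [XY' _ _]; rewrite -[Y]mulmx1 -XY' mulmxA YX mul1mx.
Qed.

(* The coordinate ring is the quotient of the polynomial ring by the polynomials
   that vanish at all points, so no generators of this ideal are needed. *)
Lemma automorphism_scheme : exists (C : comAlgType k) (X Y : 'M[C]_n),
  [/\ automorphism_pair X Y, fin_generated C,
    forall R (Z W : 'M[R]_n), automorphism_pair Z W ->
      exists f : alg_hom C R, map_mx f X = Z &
    forall R (f g : alg_hom C R), map_mx f X = map_mx g X -> f = g].
Proof.
pose I : finType := (bool * ('I_n * 'I_n))%type.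
have [P [x [Puniv Pgen]]] := free_algebra k I.
pose mat (b : bool) : 'M[P]_n := \matrix_(i, j) x (b, (i, j)).
pose zero a := forall R (f : alg_hom P R),
  automorphism_pair (map_mx f (mat true)) (map_mx f (mat false)) -> f a = 0.
have points R (Z W : 'M[R]_n) : exists f : alg_hom P R,
    map_mx f (mat true) = Z /\ map_mx f (mat false) = W.
  have [f fE] := Puniv R (fun t => if t.1 then Z t.2.1 t.2.2 else W t.2.1 t.2.2).
  by exists f; split; apply/matrixP => i j; rewrite !mxE fE.
have zero0 : zero 0 by move=> R f _; rewrite linear0.
(* The identity matrix is a point over k, so 1 does not vanish at all points and the quotient is a
   nonzero ring. *)
have zero1 : ~ zero 1.
  move=> z1; have [f [fX fY]] := points k^o 1%:M 1%:M.
  have := z1 _ f; rewrite fX fY => /(_ (automorphism_pair1 _)).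
  by rewrite rmorph1 => /eqP; rewrite [_ == _]oner_eq0.
have zeroP a u v : zero u -> zero v -> zero (a * u + v).
  by move=> zu zv R f fP; rewrite rmorphD rmorphM /= zu // zv // mulr0 addr0.
have [C [p [psurj pker plift]]] := quotient_algP (Ideal zero0 zero1 zeroP).
(* An equation holds in C as soon as it holds at all points; this makes the two matrices of
   variables an automorphism pair over C. *)
have zero_eq a b : (forall R (f : alg_hom P R),
    automorphism_pair (map_mx f (mat true)) (map_mx f (mat false)) ->
    f a = f b) -> p a = p b.
  move=> ab; apply/eqP; rewrite -subr_eq0 -rmorphB; apply/eqP/pker => R f fP.
  by rewrite rmorphB /= ab ?subrr.
have Upair : automorphism_pair (map_mx p (mat true)) (map_mx p (mat false)).
  split.
  - rewrite -map_mxM -[1%:M](map_mx1 p); apply/matrixP => i j.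
    rewrite !mxE; apply: zero_eq => R f [+ _ _].
    rewrite -map_mxM -[1%:M](map_mx1 f) => /matrixP/(_ i j).
    by rewrite !mxE.
  - rewrite -map_mxM -[1%:M](map_mx1 p); apply/matrixP => i j.
    rewrite !mxE; apply: zero_eq => R f [_ + _].
    rewrite -map_mxM -[1%:M](map_mx1 f) => /matrixP/(_ i j).
    by rewrite !mxE.
  - pose lhs r s m := \sum_l c r s l *: mat true m l.
    pose rhs r s m := \sum_r' \sum_s' c r' s' m *: (mat true r' r * mat true s' s).
    have pushl R (f : alg_hom P R) r s m :
        f (lhs r s m) = \sum_l c r s l *: map_mx f (mat true) m l.
      by rewrite linear_sum; apply: eq_bigr => l _; rewrite linearZ [in RHS]mxE.
    have pushr R (f : alg_hom P R) r s m : f (rhs r s m) =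
        \sum_r' \sum_s' c r' s' m *:
          (map_mx f (mat true) r' r * map_mx f (mat true) s' s).
      rewrite linear_sum; apply: eq_bigr => r' _.
      rewrite linear_sum; apply: eq_bigr => s' _.
      by rewrite linearZ /= rmorphM !mxE.
    apply/automorphism_mxP => r s m; rewrite -pushl -pushr.
    apply: zero_eq => R f [_ _ /automorphism_mxP].
    by rewrite pushl pushr.
exists C, (map_mx p (mat true)), (map_mx p (mat false)); split=> //.
- exists [seq p (x t) | t <- enum I] => S Salg Sx a.
  have [b <-] := psurj a.
  have [S1 Slin SM] := Salg.
  suff : b \in [pred b | p b \in S] by [].
  apply: Pgen => [|t]; last by apply: Sx; apply/map_f; rewrite mem_enum.
  split=> [|t u v|u v]; rewrite !inE.
  + by rewrite rmorph1.
  + by rewrite linearP; apply: Slin.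
  + by rewrite rmorphM; apply: SM.
- move=> R Z W ZW; have [f [fX fY]] := points R Z W.
  have [|g gf] := plift R f; first by move=> a /= za; apply: za; rewrite fX fY.
  exists g; rewrite -fX -gf; apply/matrixP => i j.
  by rewrite !mxE.
- move=> R f g fg.
  (* By uniqueness of inverses f and g agree on the second matrix as well, and the entries of both
     matrices generate C. *)
  have fg' : map_mx f (map_mx p (mat false)) = map_mx g (map_mx p (mat false)).
    apply: automorphism_pair_inv (automorphism_pair_map f Upair) _.
    by rewrite fg; apply: automorphism_pair_map.
  apply: alg_hom_ext => a; have [b <-] := psurj a.
  suff : b \in [pred b | f (p b) == g (p b)] by rewrite inE => /eqP.
  apply: Pgen => [|[[] [i j]]].
  + split=> [|t u v|u v]; rewrite !inE.
    * by rewrite !rmorph1.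
    * by move=> /eqP Su /eqP Sv; rewrite !linearP /= Su Sv.
    * by move=> /eqP Su /eqP Sv; rewrite !rmorphM /= Su Sv.
  + by rewrite inE; have /matrixP/(_ i j) := fg; rewrite !mxE => ->.
  + by rewrite inE; have /matrixP/(_ i j) := fg'; rewrite !mxE => ->.
Qed.

(** The operations come from representability, and each group axiom is a matrix identity, since a
    point is determined by its matrix. *)
Lemma automorphism_group : exists (G : algGroup k) (X : 'M[Defs.coord G]_n),
  [/\ forall R (f g : alg_hom (Defs.coord G) R), map_mx f X = map_mx g X -> f = g,
    forall R (f : alg_hom (Defs.coord G) R), automorphism_mx (map_mx f X),
    forall R (Z W : 'M[R]_n), automorphism_pair Z W ->
      exists f : alg_hom (Defs.coord G) R, map_mx f X = Z,
    forall R (f g : alg_hom (Defs.coord G) R),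
      map_mx (gmul f g) X = map_mx f X *m map_mx g X &
    forall R, map_mx (gone G R) X = 1%:M].
Proof.
have [C [X [Y [XY Cgen Cpt Cinj]]]] := automorphism_scheme.
have pt R (f : alg_hom C R) : automorphism_pair (map_mx f X) (map_mx f Y).
  exact: automorphism_pair_map.
pose hom R (Z W : 'M[R]_n) (ZW : automorphism_pair Z W) : alg_hom C R :=
  sval (cid (Cpt R Z W ZW)).
have homE R (Z W : 'M[R]_n) (ZW : automorphism_pair Z W) : map_mx (hom R Z W ZW) X = Z.
  by rewrite /hom; case: cid.
pose mul R (f g : alg_hom C R) := hom R _ _ (automorphism_pairM (pt R f) (pt R g)).
pose one R := hom R _ _ (automorphism_pair1 R).
pose inv R (f : alg_hom C R) := hom R _ _ (automorphism_pairV (pt R f)).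
have mulA R : associative (mul R).
  by move=> f g h; apply: Cinj; rewrite !homE mulmxA.
have mul1 R : left_id (one R) (mul R).
  by move=> f; apply: Cinj; rewrite !homE mul1mx.
have mulV R : left_inverse (one R) (inv R) (mul R).
  by move=> f; apply: Cinj; rewrite !homE; case: (pt R f).
have mulN R S (f : alg_hom R S) (x y : alg_hom C R) :
    alg_comp f (mul R x y) = mul S (alg_comp f x) (alg_comp f y).
  apply: Cinj; rewrite homE.
  have comp (z : alg_hom C R) : map_mx (alg_comp f z) X = map_mx f (map_mx z X).
    by apply/matrixP => i j; rewrite !mxE.
  by rewrite !comp homE map_mxM.
exists (AlgGroup Cgen mulA mul1 mulV mulN), X; split=> //= R.
- by move=> f; case: (pt R f).
- by move=> f g; rewrite homE.
- by rewrite homE.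
Qed.
End AutomorphismGroup.

Lemma lie_isomorphic_sym (k : fieldType) (g h : lieAlgType k) :
  lie_isomorphic g h -> lie_isomorphic h g.
Proof.
move=> [f [f' fK f'K] fb]; apply: (@lie_isomorphic_build _ _ _ f').
- by move=> a x y; apply: (can_inj fK); rewrite linearP !f'K.
- exact: can_inj f'K.
- by move=> y; exists (f y).
- by move=> x y; apply: (can_inj fK); rewrite fb !f'K.
Qed.

(** * Derivations as tangent vectors at the identity of the automorphism group *)

Section DerIsLie.
Context (k : fieldType) (B : vectType k) (mu : {bilinear B -> B -> B}).
Local Notation n := (dim B).

Definition base (p : 'I_n) : B := r2v (delta_mx 0 p).
Definition crd (b : B) (p : 'I_n) : k := v2r b 0 p.
Definition sconst (p q m : 'I_n) : k := crd (mu (base p) (base q)) m.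

Lemma crd_base p q : crd (base p) q = (q == p)%:R.
Proof. by rewrite /crd /base r2vK mxE eqxx. Qed.

Lemma baseE b : b = \sum_p crd b p *: base p.
Proof.
rewrite -[LHS]v2rK [v2r b]row_sum_delta linear_sum.
by apply: eq_bigr => p _; rewrite linearZ.
Qed.

Lemma crd_sum (d : 'I_n -> k) m : crd (\sum_p d p *: base p) m = d m.
Proof.
have -> : \sum_p d p *: base p = r2v (\row_p d p).
  rewrite [X in r2v X]row_sum_delta linear_sum.
  by apply: eq_bigr => p _; rewrite linearZ mxE.
by rewrite /crd r2vK mxE.
Qed.

Lemma crd_inj a b : (forall m, crd a m = crd b m) -> a = b.
Proof. by move=> ab; apply: (can_inj v2rK); apply/rowP. Qed.

Definition mx_act (d : 'M[k]_n) (b : B) : B :=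
  \sum_i (\sum_j d i j * crd b j) *: base i.

Lemma crd_act d b m : crd (mx_act d b) m = \sum_j d m j * crd b j.
Proof. exact: crd_sum. Qed.

Lemma crdZD a x y m : crd (a *: x + y) m = a * crd x m + crd y m.
Proof. by rewrite /crd linearP !mxE. Qed.

Lemma crd_linear m : linear (crd^~ m : B -> k^o).
Proof. by move=> a x y; exact: crdZD. Qed.

Lemma mx_act_linear d : linear (mx_act d).
Proof.
move=> a x y; apply: crd_inj => m; rewrite crdZD !crd_act.
rewrite mulr_sumr -big_split; apply: eq_bigr => j _ /=.
by rewrite crdZD mulrDr mulrCA.
Qed.

Lemma mx_act_base d p : mx_act d (base p) = \sum_i d i p *: base i.
Proof.
apply: eq_bigr => i _; rewrite (bigD1 p) //= crd_base eqxx mulr1 big1 ?addr0 //.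
by move=> j jp; rewrite crd_base (negPf jp) mulr0.
Qed.

Lemma base_ext (V : lmodType k) (f g : {linear B -> V}) :
  (forall p, f (base p) = g (base p)) -> forall b, f b = g b.
Proof.
move=> fg b; rewrite [b]baseE !linear_sum; apply: eq_bigr => p _.
by rewrite !linearZ /= fg.
Qed.

Definition sconst_derivation (d : 'M[k]_n) : Prop := forall p q m,
  \sum_l sconst p q l * d m l =
  \sum_l sconst l q m * d l p + \sum_l sconst p l m * d l q.

Lemma mx_act_derivation d : derivation mu (mx_act d) <-> sconst_derivation d.
Proof.
have [D DE] := linear_build (mx_act_linear d).
have {DE} DE : mx_act d = D by apply/funext => b; rewrite DE.
have lhs p q m : crd (D (mu (base p) (base q))) m = \sum_l sconst p q l * d m l.
  by rewrite -DE crd_act; apply: eq_bigr => l _; rewrite mulrC.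
have Dbase p : D (base p) = \sum_i d i p *: base i by rewrite -DE mx_act_base.
have rhs p q m : crd (mu (D (base p)) (base q) + mu (base p) (D (base q))) m =
    \sum_l sconst l q m * d l p + \sum_l sconst p l m * d l q.
  have [cm cmE] := linear_build (crd_linear m).
  have [ml mlE] := linear_build (linearPl mu (base q)).
  have [mr mrE] := linear_build (linearPr mu (base p)).
  rewrite -cmE linearD !Dbase -mlE -mrE !linear_sum.
  by congr (_ + _); apply: eq_bigr => l _;
    rewrite !linearZ ?mlE ?mrE cmE /= [LHS]mulrC.
rewrite DE; split=> [[_ Dmu] p q m|dd]; first by rewrite -lhs Dmu rhs.
split=> [|x y]; first exact: linearP.
have Dmu p q : D (mu (base p) (base q)) =
    mu (D (base p)) (base q) + mu (base p) (D (base q)).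
  by apply: crd_inj => m; rewrite lhs rhs.
have Dmul q u : D (mu u (base q)) = mu (D u) (base q) + mu u (D (base q)).
  have [f fE] : exists f : {linear B -> B}, forall x, f x = D (mu x (base q)).
    by apply: linear_build => a {}u v; rewrite linearPl linearP.
  have [g gE] : exists g : {linear B -> B},
      forall x, g x = mu (D x) (base q) + mu x (D (base q)).
    by apply: linear_build => a {}u v; rewrite linearP !linearPl scalerDr addrACA.
  by rewrite -fE -gE; apply: base_ext => p; rewrite fE gE.
have [f fE] : exists f : {linear B -> B}, forall y, f y = D (mu x y).
  by apply: linear_build => a u v; rewrite linearPr linearP.
have [g gE] : exists g : {linear B -> B}, forall y, g y = mu (D x) y + mu x (D y).
  by apply: linear_build => a u v; rewrite linearP !linearPr scalerDr addrACA.
by rewrite -fE -gE; apply: base_ext => q; rewrite fE gE.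
Qed.

(** The matrix 1 + eps d over the dual numbers of k. *)
Definition dual_mx (d : 'M[k]_n) : 'M[dual k^o]_n :=
  \matrix_(i, j) (((i == j)%:R, d i j) : dual k^o).

Lemma dual_sum (I : finType) (f : I -> dual k^o) :
  \sum_i f i = (\sum_i (f i).1, \sum_i (f i).2).
Proof. by elim/big_rec3: _ => [//|i x y z _ ->]; exact: surjective_pairing. Qed.

(** The constant part of the automorphism equations holds for the identity matrix, and the eps-part
    is the Leibniz rule in structure constants. *)
Lemma automorphism_dual_mx d :
  automorphism_mx sconst (dual_mx d) <-> sconst_derivation d.
Proof.
have lhs p q m : \sum_l sconst p q l *: dual_mx d m l =
    (sconst p q m, \sum_l sconst p q l * d m l).
  rewrite dual_sum; congr (_, _); last by apply: eq_bigr => l _; rewrite mxE.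
  rewrite (bigD1 m) //= mxE eqxx [X in X + _]mulr1 big1 ?addr0 // => l lm.
  by rewrite mxE eq_sym (negPf lm) [LHS]mulr0.
have rhs p q m : \sum_p' \sum_q' sconst p' q' m *:
      (dual_mx d p' p * dual_mx d q' q) =
    (sconst p q m, \sum_l sconst l q m * d l p + \sum_l sconst p l m * d l q).
  rewrite dual_sum; congr (_, _).
    transitivity (\sum_p' \sum_q' sconst p' q' m *
        ((p' == p)%:R * (q' == q)%:R)).
      apply: eq_bigr => p' _; rewrite dual_sum; apply: eq_bigr => q' _.
      by rewrite !mxE.
    rewrite (bigD1 p) //= (bigD1 q) //= !eqxx !mulr1 big1 => [|q' qq].
      rewrite big1 ?addr0 // => p' pp; apply: big1 => q' _.
      by rewrite (negPf pp) mul0r mulr0.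
    by rewrite (negPf qq) !mulr0.
  transitivity (\sum_p' \sum_q' (sconst p' q' m * d p' p * (q' == q)%:R +
      sconst p' q' m * d q' q * (p' == p)%:R)).
    apply: eq_bigr => p' _; rewrite dual_sum; apply: eq_bigr => q' _.
    rewrite !mxE /= -[LHS]/(sconst p' q' m *
      ((p' == p)%:R * d q' q + d p' p * (q' == q)%:R)).
    by ring.
  under eq_bigr do rewrite big_split /=.
  rewrite big_split /=; congr (_ + _).
    apply: eq_bigr => p' _; rewrite (bigD1 q) //= eqxx mulr1 big1 ?addr0 // => q' qq.
    by rewrite (negPf qq) mulr0.
  rewrite exchange_big; apply: eq_bigr => q' _ /=.
  rewrite (bigD1 p) //= eqxx mulr1 big1 ?addr0 // => p' pp.
  by rewrite (negPf pp) mulr0.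
split=> [/automorphism_mxP dP p q m|dd].
  by have := dP p q m; rewrite lhs rhs => -[].
by apply/automorphism_mxP => p q m; rewrite lhs rhs dd.
Qed.

Lemma dual_mxM d d' : dual_mx d *m dual_mx d' = dual_mx (d + d').
Proof.
apply/matrixP => i j; rewrite !mxE.
transitivity (\sum_l (((i == l)%:R * (l == j)%:R,
  (i == l)%:R * d' l j + d i l * (l == j)%:R) : dual k^o)).
  by apply: eq_bigr => l _; rewrite !mxE.
rewrite dual_sum /=; congr (_, _).
  rewrite (bigD1 i) //= eqxx mul1r big1 ?addr0 // => l li.
  by rewrite eq_sym (negPf li) mul0r.
rewrite big_split [LHS]addrC /=; congr (_ + _).
  rewrite (bigD1 j) //= eqxx mulr1 big1 ?addr0 // => l lj.
  by rewrite (negPf lj) mulr0.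
rewrite (bigD1 i) //= eqxx mul1r big1 ?addr0 // => l li.
by rewrite eq_sym (negPf li) mul0r.
Qed.

Lemma dual_mx0 : dual_mx 0 = 1%:M.
Proof. by apply/matrixP => i j; rewrite !mxE; case: eqP. Qed.

Lemma Der_Lie : exists G : algGroup k, lie_isomorphic (Lie G) (Der mu).
Proof.
have [G [X [Xinj Xaut Xpt XM X1]]] := automorphism_group sconst.
exists G; pose C := Defs.coord G; pose eps := counit G.
have Xcorep : corep (fun i j => X i j).
  move=> i j R g x; have /matrixP/(_ i j) := XM R g x; rewrite !mxE => ->.
  by apply: eq_bigr => l _; rewrite !mxE.
have epsX i j : eps (X i j) = (i == j)%:R.
  by have /matrixP/(_ i j) := X1 k^o; rewrite !mxE.
(* The derivative at the identity, in the direction of D, of the tautological representation X. *)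
pose tangent (D : C -> C) : 'M[k]_n := \matrix_(i, j) (eps (D (X i j)) : k).
have DX (D : C -> C) i j : left_invariant_derivation D ->
    D (X i j) = \sum_l tangent D l j *: X i l.
  move=> Dinv; rewrite (left_invariant_slice Dinv (Xcorep i j)).
  by apply: eq_bigr => l _; rewrite mxE.
have dual_point (D : C -> C) : left_invariant_derivation D ->
    exists f : alg_hom C (dual k^o), forall a, f a = (eps a, eps (D a)).
  move=> [dD _]; have D1 := derivation1 dD; case: dD => Dlin Dmul.
  apply: alg_hom_build => [a u v|]; first by rewrite Dlin !linearP.
  split=> [|u v]; first by rewrite D1 rmorph0 rmorph1.
  rewrite Dmul rmorphD !rmorphM; congr (_, _).
  by rewrite addrC.
have dual_pointX (D : C -> C) (f : alg_hom C (dual k^o)) :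
    (forall a, f a = (eps a, eps (D a))) -> map_mx f X = dual_mx (tangent D).
  by move=> fE; apply/matrixP => i j; rewrite !mxE fE epsX.
have linD (D : C -> C) : left_invariant_derivation D ->
    exists D' : {linear C -> C}, D = D'.
  by move=> [[/linear_build[D' D'E] _] _]; exists D'; apply/funext => x; rewrite D'E.
apply: (@lie_of_iso _ _ _ _ _ (fun D => mx_act (tangent D))).
- move=> D Dinv'; have Dinv : left_invariant_derivation D := Dinv'.
  have [f fE] := dual_point D Dinv.
  change (derivation mu (mx_act (tangent D))).
  by apply/mx_act_derivation/automorphism_dual_mx; rewrite -(dual_pointX _ f).
- move=> a D E Dinv Einv b; apply: crd_inj => m.
  rewrite crdZD !crd_act mulr_sumr -big_split; apply: eq_bigr => j _ /=.
  by rewrite !mxE linearP mulrDl mulrA.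
- move=> D E Dinv' Einv' b.
  have Dinv : left_invariant_derivation D := Dinv'.
  have Einv : left_invariant_derivation E := Einv'.
  (* A composite of two derivations need not be a derivation, but its matrix at the identity is
     still the product of the two matrices; hence commutators go to commutators. *)
  have tangentM (D1 D2 : C -> C) i j : left_invariant_derivation D1 ->
      left_invariant_derivation D2 ->
      eps (D1 (D2 (X i j))) = \sum_l tangent D1 i l * tangent D2 l j :> k.
    move=> D1inv D2inv; rewrite (DX _ _ _ D2inv).
    have [D1' D1E] := linD _ D1inv; rewrite D1E !linear_sum.
    apply: eq_bigr => l _; rewrite !linearZ /= [tangent D1' _ _]mxE.
    exact: mulrC.
  have actM (d d' : 'M[k]_n) m : crd (mx_act d (mx_act d' b)) m =
      \sum_j (\sum_l d m l * d' l j) * crd b j.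
    rewrite crd_act.
    under eq_bigr do rewrite crd_act mulr_sumr.
    rewrite exchange_big; apply: eq_bigr => j _ /=; rewrite mulr_suml.
    by apply: eq_bigr => l _; rewrite mulrA.
  apply: crd_inj => m; rewrite crd_act /commutator.
  have crdB x y : crd (x - y) m = crd x m - crd y m.
    by rewrite /crd linearB !mxE.
  rewrite crdB !actM -sumrB; apply: eq_bigr => j _.
  rewrite mxE rmorphB /= mulrBl.
  by rewrite (tangentM D E m j Dinv Einv) (tangentM E D m j Einv Dinv).
- move=> D E Dinv' Einv' DE.
  have Dinv : left_invariant_derivation D := Dinv'.
  have Einv : left_invariant_derivation E := Einv'.
  have tDE : tangent D = tangent E.
    apply/matrixP => i j; have := congr1 (fun f => crd (f (base j)) i) DE.
    by rewrite !mx_act_base !crd_sum.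
  (* The two points over the dual numbers have the same matrix, so they coincide. Thus eps o D = eps
     o E, which determines D and E. *)
  have [[f fE] [g gE]] := (dual_point _ Dinv, dual_point _ Einv).
  have fg : f = g by apply: Xinj; rewrite (dual_pointX _ _ fE) (dual_pointX _ _ gE) tDE.
  move=> a; have [m [b [c abc]]] := comul_exists a.
  rewrite (left_invariant_slice Dinv abc) (left_invariant_slice Einv abc).
  apply: eq_bigr => i _; congr (_ *: _).
  by have := gE (c i); rewrite -fg fE => -[].
- move=> E' E'der; have [Elin Emu] : derivation mu E' := E'der.
  have [E EE] := linear_build Elin.
  have {EE} EE : E' = E by apply/funext => b; rewrite EE.
  subst E'; pose d : 'M[k]_n := \matrix_(i, j) crd (E (base j)) i.
  have Ed : mx_act d = E.
    have [f fE] := linear_build (mx_act_linear d).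
    apply/funext => b; rewrite -fE; apply: base_ext => p; rewrite fE mx_act_base.
    by rewrite [RHS]baseE; apply: eq_bigr => i _; rewrite mxE.
  have dder : sconst_derivation d by apply/mx_act_derivation; rewrite Ed.
  (* The inverse of 1 + eps d is 1 - eps d, so it is a point f over the dual numbers. Its first
     component is the counit, so its second component is a point derivation. *)
  have [|f fX] := Xpt _ (dual_mx d) (dual_mx (- d)).
    split; last exact/automorphism_dual_mx.
      by rewrite dual_mxM subrr dual_mx0.
    by rewrite dual_mxM addNr dual_mx0.
  have [fst_hom fstE] : exists h : alg_hom (dual k^o) k^o, forall u, h u = u.1.
    exact: alg_hom_build.
  have fepsE : alg_comp fst_hom f = eps.
    apply: Xinj; rewrite X1; apply/matrixP => i j.
    by have /matrixP/(_ i j) := fX; rewrite !mxE /= fstE => ->.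
  have feps a : (f a).1 = eps a by rewrite -fepsE /= fstE.
  have [l lE] : exists l : {linear C -> k^o}, forall a, l a = (f a).2.
    by apply: linear_build => a x y; rewrite linearP.
  have [|D [Dinv DE _]] := @left_invariant_of_point _ G l.
    move=> a b; rewrite !lE rmorphM -!feps.
    by rewrite addrC.
  exists D => //; rewrite -Ed; congr mx_act; apply/matrixP => i j.
  rewrite mxE DE lE; have /matrixP/(_ i j) := fX; rewrite !mxE => ->.
  by [].
Qed.
End DerIsLie.

Theorem corollary1 (k : fieldType)
    (k_card : exists f : 'I_8 -> k, injective f)
    (g : vectLieAlgType k) :
  (exists G : algGroup k, lie_isomorphic g (Lie G)) <->
  (exists (A : vectType k) (mu : {bilinear A -> A -> A}),
     lie_isomorphic g (Der mu)).
Proof.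
split=> [[G gG]|[A [mu gA]]].
  have [A [mu GA]] := Lie_Der G; exists A, mu.
  exact: lie_isomorphic_trans gG GA.
have [G GA] := Der_Lie mu; exists G.
exact/(lie_isomorphic_trans gA)/lie_isomorphic_sym.
Qed.
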